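(* Suppose $\mathfrak{K}$ is a $p$-Schunck class which contains all atoms. Then $\operatorname{Envd}(\mathfrak{K})$, the class of all Lie algebras having a $p$-envelope in $\mathfrak{K}$, is a Schunck class.
   Context: All Lie algebras are finite-dimensional over a fixed field $F$ of characteristic $p\neq 0$. A restricted Lie algebra $(L,[p])$ is a Lie algebra $L$ with a $p$-operation $x\mapsto x^{[p]}$ in the usual sense; it is soluble if the Lie algebra $L$ is. A $[p]$-subalgebra is a subalgebra $U$ with $U^{[p]}\subseteq U$; a $[p]$-ideal is an ideal which is a $[p]$-subalgebra; for a $[p]$-ideal $K$, $L/K$ carries the induced $p$-operation. Classes of (restricted) Lie algebras are closed under isomorphism. A soluble Lie algebra $L$ is primitive if it has a minimal (nonzero) ideal $A$ with centraliser $\mathcal{C}_L(A)=A$. A Schunck class is a non-empty class $\mathfrak{X}$ of soluble Lie algebras which is equal to the class of all soluble Lie algebras all of whose primitive quotients are in $\mathfrak{X}$. A soluble restricted Lie algebra $(L,[p])$ is primitive if it has a minimal (nonzero) $[p]$-ideal $A$ with $\mathcal{C}_L(A)=A$. A $p$-Schunck class is a non-empty class $\mathfrak{X}$ of soluble restricted Lie algebras which is equal to the class of all soluble restricted Lie algebras all of whose primitive quotients (by $[p]$-ideals) are in $\mathfrak{X}$. An atom is a nonzero soluble restricted Lie algebra whose only $[p]$-subalgebras are $0$ and itself. A $p$-envelope of a Lie algebra $U$ is a (finite-dimensional) restricted Lie algebra $(L,[p])$ together with an injective Lie algebra homomorphism $i\colon U\to L$ such that the smallest $[p]$-subalgebra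 of $L$ containing $i(U)$ is $L$. *)

(* Defs.v *)
From HB Require Import structures.
From mathcomp Require Import all_boot all_algebra.

Set Implicit Arguments.
Unset Strict Implicit.
Unset Printing Implicit Defensive.

Import GRing.Theory.
Local Open Scope ring_scope.

Reserved Notation "\[ x , y ]" (at level 0, x, y at level 99,
  format "\[ x ,  y ]").
Reserved Notation "x ^[p]" (at level 1, format "x ^[p]").

HB.mixin Record Vector_isLie (F : fieldType) L of Vector F L := {
  lie : L -> L -> L;
  lie_linearl : forall y : L, linear (lie^~ y);
  lie_linearr : forall x : L, linear (lie x);
  liexx : forall x : L, lie x x = 0;
  lie_jacobi : forall x y z : L,
    lie x (lie y z) + lie y (lie z x) + lie z (lie x y) = 0
}.

#[short(type="lieAlgType")]
HB.structure Definition LieAlgebra (F : fieldType) :=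
  {L of Vector_isLie F L & Vector F L}.

Notation "\[ x , y ]" := (lie x y) : ring_scope.

Section JacobsonTerms.
Variables (F : fieldType) (L : lieAlgType F).

(* With t a central indeterminate, [ad_pencil_coef x y n j] is the coefficient
   of t^j in (ad (t x + y))^n (x). *)
Fixpoint ad_pencil_coef (x y : L) (n j : nat) : L :=
  if n is n'.+1 then
    (if j is j'.+1 then \[x, ad_pencil_coef x y n' j'] else 0)
      + \[y, ad_pencil_coef x y n' j]
  else if j == 0 then x else 0.

(* Jacobson's s_i(x, y), defined for 0 < i < p = char F by
   (ad (t x + y))^(p-1) (x) = \sum_(1 <= i < p) i s_i(x, y) t^(i-1). *)
Definition jacobson_s (p : nat) (x y : L) (i : nat) : L :=
  i%:R^-1 *: ad_pencil_coef x y p.-1 i.-1.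

End JacobsonTerms.

(* [p] is meant to be the characteristic of [F]; this is required where the
   structure is used. *)
HB.mixin Record Lie_isRestricted (F : fieldType) (p : nat) L
    of LieAlgebra F L := {
  ppow : L -> L;
  ad_ppow : forall x y : L, \[ppow x, y] = iter p (lie x) y;
  ppowZ : forall (a : F) (x : L), ppow (a *: x) = a ^+ p *: ppow x;
  ppowD : forall x y : L,
    ppow (x + y) = ppow x + ppow y + \sum_(1 <= i < p) jacobson_s p x y i
}.

#[short(type="restrictedLieType")]
HB.structure Definition RestrictedLie (F : fieldType) (p : nat) :=
  {L of Lie_isRestricted F p L & LieAlgebra F L}.

Notation "x ^[p]" := (ppow x) : ring_scope.

Section LieNotions.
Variables (F : fieldType) (L : lieAlgType F).
Implicit Types (A K U V : {vspace L}) (x y : L).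

Definition lie_subalg U := forall x y, x \in U -> y \in U -> \[x, y] \in U.

Definition lie_ideal K := forall x y, y \in K -> \[x, y] \in K.

(* The subspace spanned by all \[u, v], u \in U, v \in V. *)
Definition lie_prodv U V : {vspace L} :=
  <<[seq \[u, v] | u <- vbasis U, v <- vbasis V]>>%VS.

Definition derived_series (n : nat) : {vspace L} :=
  iter n (fun U => lie_prodv U U) fullv.

Definition lie_soluble := exists n, derived_series n = 0%VS.

Definition self_centralising A :=
  forall x, (forall a, a \in A -> \[x, a] = 0) <-> x \in A.

Definition minimal_ideal A :=
  [/\ lie_ideal A, A != 0%VS
    & forall B : {vspace L}, lie_ideal B -> (B <= A)%VS -> B != 0%VS -> B = A].

Definition lie_primitive :=
  lie_soluble /\ exists A, minimal_ideal A /\ self_centralising A.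

End LieNotions.

Arguments lie_soluble {F} L.
Arguments lie_primitive {F} L.

Section RestrictedNotions.
Variables (F : fieldType) (p : nat) (L : restrictedLieType F p).
Implicit Types (A K U V : {vspace L}) (x y : L).

Definition p_closed U := forall x, x \in U -> x^[p] \in U.

Definition p_subalg U := lie_subalg U /\ p_closed U.

Definition p_ideal K := lie_ideal K /\ p_subalg K.

Definition minimal_p_ideal A :=
  [/\ p_ideal A, A != 0%VS
    & forall B : {vspace L}, p_ideal B -> (B <= A)%VS -> B != 0%VS -> B = A].

Definition p_primitive :=
  lie_soluble L /\ exists A, minimal_p_ideal A /\ self_centralising A.

Definition p_atom :=
  [/\ lie_soluble L, (fullv : {vspace L}) != 0%VS
    & forall U, p_subalg U -> U = 0%VS \/ U = fullv].

Definition smallest_p_subalg (S V : {vspace L}) :=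
  [/\ p_subalg V, (S <= V)%VS
    & forall W : {vspace L}, p_subalg W -> (S <= W)%VS -> (V <= W)%VS].

End RestrictedNotions.

Arguments p_primitive {F p} L.
Arguments p_atom {F p} L.

Section Morphisms.
Variable F : fieldType.

Definition lie_hom (L M : lieAlgType F) (f : 'Hom(L, M)) :=
  forall x y, f \[x, y] = \[f x, f y].

Definition lie_isog (L M : lieAlgType F) :=
  exists f : 'Hom(L, M), lie_hom f /\ bijective f.

Definition p_isog (p : nat) (L M : restrictedLieType F p) :=
  exists f : 'Hom(L, M),
    [/\ lie_hom f, forall x, f x^[p] = (f x)^[p] & bijective f].

Definition p_envelope (p : nat) (U : lieAlgType F) (L : restrictedLieType F p)
    (i : 'Hom(U, L)) :=
  [/\ lie_hom i, injective i & smallest_p_subalg (limg i) fullv].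

End Morphisms.

Section LieTheory.
Variables (F : fieldType) (L : lieAlgType F).
Implicit Types (x y z : L).

Lemma lieDl x x' y : \[x + x', y] = \[x, y] + \[x', y].
Proof. by have := lie_linearl y 1 x x'; rewrite /= !scale1r. Qed.

Lemma lieDr x y y' : \[x, y + y'] = \[x, y] + \[x, y'].
Proof. by have := lie_linearr x 1 y y'; rewrite /= !scale1r. Qed.

Lemma lie0x y : \[0, y] = 0.
Proof. by apply: (addrI \[0, y]); rewrite -lieDl !addr0. Qed.

Lemma liex0 x : \[x, 0] = 0.
Proof. by apply: (addrI \[x, 0]); rewrite -lieDr !addr0. Qed.

Lemma lieC x y : \[x, y] = - \[y, x].
Proof.
apply/eqP; rewrite -addr_eq0; apply/eqP.
by have := liexx (x + y); rewrite lieDl !lieDr !liexx add0r addr0.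
Qed.

Lemma lieZl a x y : \[a *: x, y] = a *: \[x, y].
Proof. by have := lie_linearl y a x 0; rewrite /= lie0x !addr0. Qed.

Lemma lieZr a x y : \[x, a *: y] = a *: \[x, y].
Proof. by have := lie_linearr x a y 0; rewrite /= liex0 !addr0. Qed.

Lemma lie_ideall (K : {vspace L}) x y :
  lie_ideal K -> x \in K -> \[x, y] \in K.
Proof. by move=> idK Kx; rewrite lieC memvN; apply: idK. Qed.

Lemma ad_pencil_coef_ideal (K : {vspace L}) x k n j :
  lie_ideal K -> k \in K -> (j < n)%N -> ad_pencil_coef x k n j \in K.
Proof.
move=> idK Kk; elim: n j => [//|n IHn] [|j] ltjn /=.
  by rewrite add0r lie_ideall.
by apply: memvD; [apply/idK/IHn | apply: lie_ideall].
Qed.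

End LieTheory.

(* The quotient L / K. Its carrier is a linear complement of K in L, each
   element of which represents its coset; [lie_quot_proj], the projection along
   K onto this complement, is the canonical surjection. *)
Section Quotient.
Variables (F : fieldType) (L : lieAlgType F) (K : {vspace L}).

Definition lie_quot (idK : lie_ideal K) : Type := subvs_of (K^C)%VS.

Variable idK : lie_ideal K.
Local Notation Q := (lie_quot idK).

HB.instance Definition _ := Vector.on Q.

Definition lie_quot_proj (x : L) : Q := Subvs (memv_pi (K^C)%VS K x).

Definition lie_quot_repr (u : Q) : L := vsval u.

Lemma lie_quot_proj_is_linear : linear lie_quot_proj.
Proof. by move=> a x y; apply: val_inj; rewrite /= linearP. Qed.

HB.instance Definition _ :=
  GRing.isLinear.Build F L Q *:%R lie_quot_proj lie_quot_proj_is_linear.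

Lemma lie_quot_repr_is_linear : linear lie_quot_repr.
Proof. by []. Qed.

HB.instance Definition _ :=
  GRing.isLinear.Build F Q L *:%R lie_quot_repr lie_quot_repr_is_linear.

Let capKcK : ((K^C)%VS :&: K = 0)%VS.
Proof. by rewrite capvC capv_compl. Qed.

Lemma lie_quot_reprK : cancel lie_quot_repr lie_quot_proj.
Proof. by move=> u; apply: val_inj; rewrite /= daddv_pi_id ?subvsP. Qed.

Lemma lie_quot_projK x : x - lie_quot_repr (lie_quot_proj x) \in K.
Proof.
have E : daddv_pi (K^C)%VS K x + daddv_pi K (K^C)%VS x = x.
  by rewrite (daddv_pi_add capKcK) // addvC addv_complf memvf.
by rewrite /lie_quot_repr /= -[X in X - _]E addrC addKr memv_pi.
Qed.

Lemma lie_quot_proj_eq0 x : (lie_quot_proj x == 0) = (x \in K).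
Proof.
apply/eqP/idP => [px0|Kx].
  by have := lie_quot_projK x; rewrite px0 [lie_quot_repr 0]linear0 subr0.
have Kpx : lie_quot_repr (lie_quot_proj x) \in K.
  by have := memvB Kx (lie_quot_projK x); rewrite subKr.
apply: val_inj; apply/eqP; rewrite /= -memv0 -capKcK memv_cap.
by rewrite memv_pi.
Qed.

Lemma lie_quot_proj_eq x y :
  x - y \in K -> lie_quot_proj x = lie_quot_proj y.
Proof.
by rewrite -lie_quot_proj_eq0 linearB subr_eq0 => /eqP.
Qed.

Definition lie_quot_bracket (u v : Q) : Q :=
  lie_quot_proj \[lie_quot_repr u, lie_quot_repr v].

Lemma lie_quot_bracketE x y :
  lie_quot_bracket (lie_quot_proj x) (lie_quot_proj y) = lie_quot_proj \[x, y].
Proof.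
rewrite /lie_quot_bracket.
set a := lie_quot_repr _; set b := lie_quot_repr (lie_quot_proj y).
have -> : \[x, y] = \[a, b] + (\[x - a, b] + \[x, y - b]).
  by rewrite addrA -lieDl [a + _]addrC subrK -lieDr [b + _]addrC subrK.
apply/esym/lie_quot_proj_eq; rewrite [X in X - _]addrC addrK.
by apply: memvD; [apply: lie_ideall | apply: idK] => //; apply: lie_quot_projK.
Qed.

Lemma lie_quot_linearl v : linear (lie_quot_bracket^~ v).
Proof.
by move=> a u u'; rewrite /lie_quot_bracket linearP lieDl lieZl linearP.
Qed.

Lemma lie_quot_linearr u : linear (lie_quot_bracket u).
Proof.
by move=> a v v'; rewrite /lie_quot_bracket linearP lieDr lieZr linearP.
Qed.

Lemma lie_quotxx u : lie_quot_bracket u u = 0.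
Proof. by rewrite /lie_quot_bracket liexx linear0. Qed.

Lemma lie_quot_jacobi u v w :
  lie_quot_bracket u (lie_quot_bracket v w)
    + lie_quot_bracket v (lie_quot_bracket w u)
    + lie_quot_bracket w (lie_quot_bracket u v) = 0.
Proof.
rewrite -[u]lie_quot_reprK -[v]lie_quot_reprK -[w]lie_quot_reprK.
by rewrite !lie_quot_bracketE -!linearD lie_jacobi linear0.
Qed.

HB.instance Definition _ := Vector_isLie.Build F Q
  lie_quot_linearl lie_quot_linearr lie_quotxx lie_quot_jacobi.

Lemma lie_quot_projM x y :
  lie_quot_proj \[x, y] = \[lie_quot_proj x, lie_quot_proj y].
Proof. exact/esym/lie_quot_bracketE. Qed.

Lemma lie_quot_proj_iter n x y :
  lie_quot_proj (iter n (lie x) y)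
    = iter n (lie (lie_quot_proj x)) (lie_quot_proj y).
Proof. by elim: n => //= n IHn; rewrite lie_quot_projM IHn. Qed.

Lemma lie_quot_proj_jacobson p x y i :
  lie_quot_proj (jacobson_s p x y i)
    = jacobson_s p (lie_quot_proj x) (lie_quot_proj y) i.
Proof.
rewrite /jacobson_s linearZ /=; congr (_ *: _).
elim: (p.-1) (i.-1) => [|n IHn] j /=; first by case: eqP; rewrite ?linear0.
rewrite linearD /= lie_quot_projM IHn; congr (_ + _).
by case: j => [|j]; rewrite ?linear0 // lie_quot_projM IHn.
Qed.

End Quotient.

Section RestrictedQuotient.
Variables (F : fieldType) (p : nat) (L : restrictedLieType F p).
Variable K : {vspace L}.

Lemma p_ideal_lie : p_ideal K -> lie_ideal K.
Proof. by case. Qed.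

Definition p_quot (pK : p_ideal K) : Type := lie_quot (p_ideal_lie pK).

Variable pK : p_ideal K.
Local Notation Q := (p_quot pK).

HB.instance Definition _ := LieAlgebra.on Q.

Definition p_quot_proj (x : L) : Q := lie_quot_proj (p_ideal_lie pK) x.

Definition p_quot_repr (u : Q) : L := @lie_quot_repr F L K (p_ideal_lie pK) u.

HB.instance Definition _ := GRing.isLinear.Build F L Q *:%R p_quot_proj
  (lie_quot_proj_is_linear (p_ideal_lie pK)).

HB.instance Definition _ := GRing.isLinear.Build F Q L *:%R p_quot_repr
  (lie_quot_repr_is_linear (idK := p_ideal_lie pK)).

Lemma p_quot_reprK : cancel p_quot_repr p_quot_proj.
Proof. exact: lie_quot_reprK. Qed.

Definition p_quot_ppow (u : Q) : Q := p_quot_proj (p_quot_repr u)^[p].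

Lemma p_quot_ad_ppow (u v : Q) : \[p_quot_ppow u, v] = iter p (lie u) v.
Proof.
rewrite -[v in LHS]p_quot_reprK -[LHS]lie_quot_projM ad_ppow.
have /= -> := lie_quot_proj_iter (p_ideal_lie pK) p (p_quot_repr u).
by rewrite !lie_quot_reprK.
Qed.

Lemma p_quot_ppowZ (a : F) (u : Q) :
  p_quot_ppow (a *: u) = a ^+ p *: p_quot_ppow u.
Proof. by rewrite /p_quot_ppow linearZ /= ppowZ linearZ. Qed.

Lemma p_quot_ppowD (u v : Q) :
  p_quot_ppow (u + v) = p_quot_ppow u + p_quot_ppow v
    + \sum_(1 <= i < p) jacobson_s p u v i.
Proof.
rewrite /p_quot_ppow linearD /= ppowD !linearD linear_sum /=.
congr (_ + _); apply: eq_bigr => i _.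
by rewrite [LHS]lie_quot_proj_jacobson !lie_quot_reprK.
Qed.

HB.instance Definition _ := Lie_isRestricted.Build F p Q
  p_quot_ad_ppow p_quot_ppowZ p_quot_ppowD.

(* The p-operation of L / K is the one induced by that of L. *)
Lemma p_quot_projX (x : L) : p_quot_proj x^[p] = (p_quot_proj x)^[p].
Proof.
set r := p_quot_repr (p_quot_proj x).
have Kk : x - r \in K by apply: lie_quot_projK.
rewrite -{1}[x](subrK r) [_ + r]addrC ppowD.
apply: lie_quot_proj_eq; rewrite -[X in X - _]addrA [X in X - _]addrC addrK.
have [idK [_ pclK]] := pK.
apply: memvD; first exact: pclK.
rewrite big_nat; apply: memv_suml => i /andP[i_gt0 ltip].
rewrite memvZ // ad_pencil_coef_ideal //.
by case: i i_gt0 ltip => // i _; case: p.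
Qed.

End RestrictedQuotient.

(* A class of (restricted) Lie algebras is a predicate invariant under
   isomorphism. *)
Section Classes.
Variable F : fieldType.

Definition lie_class (X : lieAlgType F -> Prop) :=
  forall L M : lieAlgType F, lie_isog L M -> X L -> X M.

Definition p_lie_class (p : nat) (X : restrictedLieType F p -> Prop) :=
  forall L M : restrictedLieType F p, p_isog L M -> X L -> X M.

Definition schunck_class (X : lieAlgType F -> Prop) :=
  [/\ lie_class X,
      exists L, X L
    & forall L : lieAlgType F, X L <->
        (lie_soluble L /\
         forall (K : {vspace L}) (idK : lie_ideal K),
           lie_primitive (lie_quot idK) -> X (lie_quot idK))].

Definition p_schunck_class (p : nat) (X : restrictedLieType F p -> Prop) :=
  [/\ p_lie_class X,
      exists L, X L
    & forall L : restrictedLieType F p, X L <->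
        (lie_soluble L /\
         forall (K : {vspace L}) (pK : p_ideal K),
           p_primitive (p_quot pK) -> X (p_quot pK))].

Definition Envd (p : nat) (X : restrictedLieType F p -> Prop)
    (U : lieAlgType F) : Prop :=
  exists (L : restrictedLieType F p) (i : 'Hom(U, L)), p_envelope i /\ X L.

End Classes.

(* Main.v *)
Require Import Defs.
From HB Require Import structures.
From mathcomp Require Import all_boot all_algebra all_field.
From Stdlib Require Import Classical_Prop.

Set Implicit Arguments.
Unset Strict Implicit.
Unset Printing Implicit Defensive.

Import GRing.Theory.
Local Open Scope ring_scope.

(** The class Envd(K) is compared with K through two facts about a p-envelope
    [L] of a Lie algebra [U]: every ideal of [U] is an ideal of [L], and
    [\[L, L]] lies in [U]. Both hold because normalisers and centralisers,
    more generally the transporters [{x | \[x, A] <= B}] with [B <= A], are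
    [[p]]-subalgebras, so that one containing [U] is all of [L].

    Let [L] in K be a p-envelope of [U] and let [Q = U / I] be primitive. If
    [Q] has a nonzero centre, then [Q] is a line, and the line with zero
    p-operation is an atom. Otherwise [J = {x | \[x, U] <= I}] is a [[p]]-ideal
    of [L] meeting [U] exactly in [I], and [L / J] is a p-envelope of [Q]; it
    lies in K since K is closed under quotients
    ([Envd_primitive_quotient]).

    Conversely let [U] be soluble with all its primitive quotients in Envd(K),
    and let [L] be any p-envelope of [U]; then [L] is in K. Indeed, let
    [M = L / J] be primitive, with minimal [[p]]-ideal [A] equal to its
    centraliser. If [M] has a nonzero centre, then [M] is abelian and an atom.
    Otherwise [a^[p]] is central for [a] in [A], because [(ad a)^2 = 0], so the
    p-operation vanishes on [A] and [A] is minimal even among ideals. Then [A]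
    is inside the image [Q] of [U], and [Q] is primitive, hence has a p-envelope
    [E] in K. As [M] acts faithfully on [Q], and both [E] and [M] act on [Q] as
    the [[p]]-algebra of operators generated by [ad Q], there is a surjection
    from [E] to [M] ([envelopes_compare]). So [M] is in K
    ([Envd_of_primitive_quotients]).

    This requires that a soluble [U] has some finite-dimensional p-envelope,
    which follows from a faithful finite-dimensional representation
    ([ado_soluble]): matrices form a restricted Lie algebra by Jacobson's
    formula for [(x + y)^p] ([comm_ppowD]). The representation is extended from
    an ideal [M] to [M + F x] by coinduction. The coinduced module is the space
    of sequences in the module of [M], with [x] acting as the shift [S]. If
    [P] is a p-polynomial with [P(ad x) = 0], then [P(S)] commutes with the
    action, since [S^(p^e)] obeys a Leibniz rule without mixed terms; hence the
    sequences killed by [P(S)] form a submodule, which has finite dimension. *)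

(** * Binomial expansions in characteristic p *)

(** [T n i j] stands for [n] applications of a sum of two commuting operators
    to a term on which they have already been applied [i] and [j] times. No ring
    of operators is needed, so the lemma serves both for commutators and for the
    Leibniz rule of a module action. *)
Lemma pascal_expansion (V : zmodType) (T : nat -> nat -> nat -> V) :
    (forall n i j, T n.+1 i j = T n i.+1 j + T n i j.+1) ->
  forall n i j,
    T n i j = \sum_(k < n.+1) T 0%N (i + k)%N (j + (n - k))%N *+ 'C(n, k).
Proof.
move=> TS; elim=> [|n IHn] i j; first by rewrite big_ord1 !addn0 bin0.
rewrite TS !IHn [RHS]big_ord_recl bin0 subn0 addn0.
under [X in _ = _ + X]eq_bigr => k _ do
  rewrite /= /bump /= add1n subSS binS mulrnDr.
rewrite big_split /= addrA addrC; congr (_ + _).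
  by apply: eq_bigr => k _; rewrite addSnnS.
rewrite big_ord_recl bin0 subn0 addn0 addSnnS; congr (_ + _).
rewrite [RHS]big_ord_recr /= bin_small // mulr0n addr0.
by apply: eq_bigr => k _; rewrite /bump /= add1n addSnnS -subSn.
Qed.

Lemma pascal_expansion_prime (V : zmodType) (p : nat)
    (T : nat -> nat -> nat -> V) :
    prime p -> (forall v : V, v *+ p = 0) ->
    (forall n i j, T n.+1 i j = T n i.+1 j + T n i j.+1) ->
  forall i j, T p i j = T 0%N (i + p)%N j + T 0%N i (j + p)%N.
Proof.
move=> pr_p Vp TS i j; rewrite (pascal_expansion TS).
rewrite big_ord_recr binn subnn addn0 /= addrC; congr (_ + _).
case: p pr_p Vp => // p pr_p Vp; rewrite big_ord_recl /= bin0 addn0 subn0.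
rewrite big1 ?addr0 // => k _.
have /dvdnP[q ->]: (p.+1 %| 'C(p.+1, bump 0 k))%N.
  by rewrite prime_dvd_bin // /bump /= ltnS ltn_ord.
by rewrite mulrnA Vp.
Qed.

(** * Associative algebras as restricted Lie algebras *)

(** The characteristic is an argument because it fixes the exponent of the
    p-operation. *)
Definition comm_lie (F : fieldType) (p : nat) (charFp : p \in [pchar F])
  (A : falgType F) : Type := A.

Section CommutatorLie.
Variables (F : fieldType) (p : nat) (charFp : p \in [pchar F]).
Variable A : falgType F.
Local Notation G := (comm_lie charFp A).
Implicit Types x y z : A.

HB.instance Definition _ := Vector.on G.

Definition comm_bracket x y : A := x * y - y * x.

Lemma comm_linearl y : linear (comm_bracket^~ y).
Proof.
move=> a x x'; rewrite /comm_bracket mulrDl mulrDr -scalerAl -scalerAr.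
by rewrite scalerBr opprD addrACA.
Qed.

Lemma comm_linearr x : linear (comm_bracket x).
Proof.
move=> a y y'; rewrite /comm_bracket mulrDl mulrDr -scalerAl -scalerAr.
by rewrite scalerBr opprD addrACA.
Qed.

Lemma commxx x : comm_bracket x x = 0.
Proof. exact: subrr. Qed.

Lemma comm_jacobi x y z :
  comm_bracket x (comm_bracket y z) + comm_bracket y (comm_bracket z x)
    + comm_bracket z (comm_bracket x y) = 0.
Proof.
rewrite /comm_bracket !mulrBl !mulrBr !mulrA !opprB !addrA.
rewrite (ACl (1*12*11*6*7*2*9*8*3*10*5*4)) /=.
by rewrite !(subrr, add0r).
Qed.

(** Left multiplication by [x] is the sum of the commuting operators [ad x] and
    right multiplication by [x]; only the extreme terms of its p-th power
    survive. *)
Lemma iter_ad_prime x y : iter p (comm_bracket x) y = comm_bracket (x ^+ p) y.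
Proof.
pose T n i j := x ^+ n * iter i (comm_bracket x) y * x ^+ j.
have TS m i j : T m.+1 i j = T m i.+1 j + T m i j.+1.
  by rewrite /T /= exprSr exprS /comm_bracket !mulrBr !mulrBl !mulrA subrK.
have pA (v : A) : v *+ p = 0 by rewrite -mulr_natl pcharf0 ?mul0r // pchar_lalg.
have := pascal_expansion_prime (pcharf_prime charFp) pA TS 0%N 0%N.
rewrite /T /= !mulr1 !mul1r => xpy.
by rewrite [RHS]/comm_bracket xpy addrK.
Qed.

End CommutatorLie.

(** The derivative is [\sum_k u^k u' u^(n-1-k)]; moving every power of [u] to
    the right of [u'] produces the iterated commutators. *)
Lemma deriv_exp_ad (R : nzRingType) (u : {poly R}) n :
  (u ^+ n)^`() = \sum_(j < n)
    iter j (fun v => u * v - v * u) u^`() * u ^+ (n - j.+1) *+ 'C(n, j.+1).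
Proof.
elim: n => [|n IHn]; first by rewrite expr0 big_ord0 derivC.
rewrite exprS derivM IHn mulr_sumr.
set ad := fun v : {poly R} => _.
under eq_bigr => j _ do rewrite mulrnAr mulrA
  -[u * _](subrK (iter j ad u^`() * u)) -/(ad _) mulrDl -mulrA -exprS mulrnDl.
under [RHS]eq_bigr => j _ do rewrite subSS binS mulrnDr.
rewrite !big_split /= addrA addrC; congr (_ + _).
  rewrite [RHS]big_ord_recr /= bin_small // addr0.
  by apply: eq_bigr => j _; rewrite -subSn.
by rewrite [RHS]big_ord_recl subn0 bin0; congr (_ + _).
Qed.

(** All ['C(p, j.+1)] with [j.+1 < p] vanish. *)
Lemma deriv_exp_pchar (R : nzRingType) (p : nat) (u : {poly R}) :
    p \in [pchar R] ->
  (u ^+ p)^`() = iter p.-1 (fun v => u * v - v * u) u^`().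
Proof.
move=> charRp; have pr_p := pcharf_prime charRp.
rewrite deriv_exp_ad -[in LHS](prednK (prime_gt0 pr_p)) big_ord_recr /=.
rewrite prednK ?prime_gt0 // binn subnn expr0 mulr1 big1 ?add0r // => j _.
have /dvdnP[q ->]: (p %| 'C(p, j.+1))%N.
  by rewrite prime_dvd_bin //= -ltn_predRL ltn_ord.
by rewrite mulrnA -mulr_natl pcharf0 ?mul0r // pchar_poly.
Qed.

Section CommutatorRestricted.
Variables (F : fieldType) (p : nat) (charFp : p \in [pchar F]).
Variable A : falgType F.
Local Notation G := (comm_lie charFp A).
Implicit Types x y z : A.

HB.instance Definition _ := Vector_isLie.Build F G
  (@comm_linearl F A) (@comm_linearr F A) (@commxx F A) (@comm_jacobi F A).

Lemma coef_ad_pencil x y n j :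
  (iter n (fun v => (x%:P * 'X + y%:P) * v - v * (x%:P * 'X + y%:P)) x%:P)`_j
    = ad_pencil_coef (x : G) (y : G) n j.
Proof.
elim: n j => [|n IHn] j /=; first by rewrite coefC.
set v := iter n _ _ in IHn *.
rewrite mulrDl mulrDr opprD addrACA coefD !coefB.
rewrite -mulrA -commr_polyX !mulrA !coefMX !coefCM !coefMC !IHn.
by case: j => [|j] /=; rewrite ?subr0 // !IHn.
Qed.

(** Jacobson's formula: the coefficients [c_i] of [(x t + y)^p] are found by
    differentiating in [t], as [i c_i] is the coefficient of [t^(i-1)] in
    [ad (x t + y)^(p-1) (x)]. The value at [t = 1] is [(x + y)^p]. *)
Lemma comm_ppowD x y :
  (x + y) ^+ p = x ^+ p + y ^+ p
    + \sum_(1 <= i < p) jacobson_s p (x : G) (y : G) i.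
Proof.
have pr_p := pcharf_prime charFp; have p_gt0 := prime_gt0 pr_p.
have charAp : p \in [pchar A] by rewrite pchar_lalg.
pose u : {poly A} := x%:P * 'X + y%:P.
have sz_exp n : (size (u ^+ n)%R <= n.+1)%N.
  apply: leq_trans (size_poly_exp_leq _ _) _.
  have: (size u <= 2)%N.
    by rewrite size_MXaddC; case: ifP => // _; rewrite ltnS size_polyC leq_b1.
  rewrite ltnS -[X in _ -> (_ <= X)%N]mul1n leq_mul2r.
  by case: (size u) => [|[|[|]]] //=; rewrite orbT.
have coef_top n : (u ^+ n)`_n = x ^+ n.
  elim: n => [|n IHn]; first by rewrite coefC.
  rewrite !exprS mulrDl coefD -mulrA -commr_polyX mulrA coefMX !coefCM IHn /=.
  by rewrite [_`_n.+1]nth_default ?mulr0 ?addr0.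
have coef0 n : (u ^+ n)`_0 = y ^+ n.
  elim: n => [|n IHn]; first by rewrite coefC.
  rewrite !exprS mulrDl coefD -mulrA -commr_polyX mulrA coefMX !coefCM.
  by rewrite add0r IHn.
have eval n : (u ^+ n).[1] = (x + y) ^+ n.
  rewrite horner_exp_comm; first by rewrite hornerMXaddC hornerC mulr1.
  by rewrite /comm_poly mul1r mulr1.
have coef_mid i : (0 < i < p)%N ->
    (u ^+ p)`_i = jacobson_s p (x : G) (y : G) i.
  case: i => // i /= ltip.
  have i_neq0: (i.+1)%:R != 0 :> F.
    by rewrite -(dvdn_pcharf charFp) gtnNdvd.
  rewrite /jacobson_s -coef_ad_pencil.
  have <- : (u ^+ p)^`() = iter p.-1 (fun v => u * v - v * u) x%:P.
    by rewrite (deriv_exp_pchar _ charAp) derivMXaddC /= derivC mul0r addr0.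
  by rewrite coef_deriv -scaler_nat scalerA mulVf ?scale1r.
rewrite -eval (horner_coef_wide _ (sz_exp _)) -(big_mkord xpredT
  (fun i => (u ^+ p)`_i * 1 ^+ i)) big_nat_recr //= big_ltn //.
rewrite !expr1n !mulr1 coef0 coef_top addrC addrA; congr (_ + _).
rewrite [RHS]big_nat [LHS]big_nat; apply: eq_bigr => i i_int.
by rewrite expr1n mulr1 coef_mid.
Qed.

Lemma comm_ppowZ (a : F) x : (a *: x) ^+ p = a ^+ p *: x ^+ p.
Proof. exact: exprZn. Qed.

Lemma comm_ad_ppow x y :
  comm_bracket (x ^+ p) y = iter p (comm_bracket x) y.
Proof. by rewrite (iter_ad_prime charFp). Qed.

HB.instance Definition _ := Lie_isRestricted.Build F p G
  comm_ad_ppow comm_ppowZ comm_ppowD.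

End CommutatorRestricted.

(** * Linearity of the bracket *)

Section Adjoint.
Variables (F : fieldType) (L : lieAlgType F).

HB.instance Definition _ (x : L) :=
  GRing.isLinear.Build F L L *:%R (lie x) (lie_linearr x).

(** The map [lie^~ y] as a constant, so that it can carry a linear structure. *)
Definition lie_flip (y x : L) := \[x, y].

HB.instance Definition _ (y : L) :=
  GRing.isLinear.Build F L L *:%R (lie_flip y) (lie_linearl y).

Lemma lie_jacobi_der (x y z : L) :
  \[x, \[y, z]] = \[\[x, y], z] + \[y, \[x, z]].
Proof.
have := lie_jacobi x y z; rewrite [\[z, \[x, y]]]lieC [\[z, x]]lieC.
rewrite -[- \[x, z]]scaleN1r lieZr scaleN1r => /eqP.
by rewrite subr_eq0 subr_eq => /eqP.
Qed.

Lemma lie_suml I (r : seq I) (P : pred I) (f : I -> L) y :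
  \[\sum_(i <- r | P i) f i, y] = \sum_(i <- r | P i) \[f i, y].
Proof. exact: (linear_sum (lie_flip y)). Qed.

Lemma lie_sumr I (r : seq I) (P : pred I) (f : I -> L) x :
  \[x, \sum_(i <- r | P i) f i] = \sum_(i <- r | P i) \[x, f i].
Proof. exact: (linear_sum (lie x)). Qed.

End Adjoint.

(** * Sequences with a linear recurrence *)

Section Recurrence.
Variables (F : fieldType) (V : lmodType F) (N n : nat).
Variables (a : 'I_n -> F) (d : 'I_n -> nat).
Hypotheses (N_gt0 : (0 < N)%N) (ltdN : forall e, (d e < N)%N).

Definition recurrent (f : nat -> V) :=
  forall k, f (k + N)%N = \sum_(e < n) a e *: f (k + d e)%N.

(** The shift on the first [N] terms, where the missing last term is supplied
    by the recurrence; it acts on all sequences, but only terms below [N]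
    matter. *)
Definition companion (g : nat -> V) (j : nat) : V :=
  if (j.+1 < N)%N then g j.+1 else \sum_(e < n) a e *: g (d e).

Definition extend (g : nat -> V) (k : nat) : V := iter k companion g 0%N.

Lemma iter_companion k g j :
  (j + k < N)%N -> iter k companion g j = g (j + k)%N.
Proof.
elim: k j => [|k IHk] j ltjkN; first by rewrite addn0.
rewrite iterS /companion -/companion (leq_ltn_trans _ ltjkN).
  by rewrite IHk ?addSnnS.
by rewrite addnS ltnS leq_addr.
Qed.

Lemma extend_lt g k : (k < N)%N -> extend g k = g k.
Proof. by move=> ltkN; rewrite /extend iter_companion. Qed.

Lemma extend_recurrent g : recurrent (extend g).
Proof.
move=> k; rewrite /extend addnC iterD; set h := iter k _ _.
have -> : iter N companion h 0%N = \sum_(e < n) a e *: h (d e).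
  rewrite -[X in iter X](prednK N_gt0) iterSr iter_companion ?prednK //.
  by rewrite /companion add0n prednK // ltnn.
by apply: eq_bigr => e _; rewrite addnC iterD (@iter_companion (d e)) ?add0n.
Qed.

Lemma recurrent_extend f g :
  recurrent f -> (forall k, (k < N)%N -> g k = f k) -> extend g =1 f.
Proof.
move=> fR eq_gf k; elim/ltn_ind: k => k IHk.
have [ltkN|leNk] := ltnP k N; first by rewrite extend_lt ?eq_gf.
rewrite -(subnK leNk) extend_recurrent fR; apply: eq_bigr => e _.
by rewrite IHk // -[ltnRHS](subnK leNk) ltn_add2l.
Qed.

End Recurrence.

(** * Coinduction from an ideal of codimension one *)

Section Coinduction.
Variables (F : fieldType) (U : lieAlgType F) (V : vectType F).
Variables (rho : U -> V -> V) (x : U).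
Hypotheses (rho_linearl : forall v, linear (rho^~ v)).
Hypotheses (rho_linearr : forall u, linear (rho u)).

(** A sequence [f] is the element of [Hom_(U(M)) (U(M + F x), V)] with value
    [f k] at [x^k]. The recursion is the rule [x m = \[x, m] + m x], that is, the
    shift intertwines with [m] through [ad x]; it avoids the closed formula
    [\sum_j 'C(k, j) rho ((ad x)^j m) (f (k - j))]. *)
Fixpoint coaction (k : nat) (m : U) (f : nat -> V) : V :=
  if k is k'.+1 then
    coaction k' \[x, m] f + coaction k' m (fun i => f i.+1)
  else rho m (f 0%N).

Lemma eq_coaction k m f g : f =1 g -> coaction k m f = coaction k m g.
Proof.
elim: k m f g => [|k IHk] m f g eq_fg /=; first by rewrite eq_fg.
by rewrite (IHk _ _ _ eq_fg) (IHk m _ (fun i => g i.+1)) // => i.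
Qed.

Lemma coaction_linearl k f : linear (fun m => coaction k m f).
Proof.
elim: k f => [|k IHk] f b m m' /=; first exact: rho_linearl.
by rewrite linearP !IHk scalerDr addrACA.
Qed.

Lemma coaction_linearr k m b f g :
  coaction k m (fun i => b *: f i + g i) = b *: coaction k m f + coaction k m g.
Proof.
elim: k m f g => [|k IHk] m f g /=; first exact: rho_linearr.
by rewrite !IHk scalerDr addrACA.
Qed.

Lemma coaction_suml k f n (b : 'I_n -> F) (m : 'I_n -> U) :
  coaction k (\sum_(e < n) b e *: m e) f
    = \sum_(e < n) b e *: coaction k (m e) f.
Proof.
pose h : {linear U -> V} := HB.pack (fun m => coaction k m f)
  (GRing.isLinear.Build F U V *:%R _ (coaction_linearl k f)).
rewrite -[LHS]/(h _) linear_sum; apply: eq_bigr => e _; exact: linearZ.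
Qed.

Lemma coactionDr k m f g :
  coaction k m (fun i => f i + g i) = coaction k m f + coaction k m g.
Proof.
rewrite -[X in X + _]scale1r -coaction_linearr.
by apply: eq_coaction => i; rewrite scale1r.
Qed.

Lemma coaction0 k m : coaction k m (fun=> 0) = 0.
Proof.
by apply: (addrI (coaction k m (fun=> 0))); rewrite -coactionDr !addr0.
Qed.

Lemma coaction_sumr k m n (b : 'I_n -> F) (f : 'I_n -> nat -> V) :
  coaction k m (fun i => \sum_(e < n) b e *: f e i)
    = \sum_(e < n) b e *: coaction k m (f e).
Proof.
elim: n b f => [|n IHn] b f.
  rewrite big_ord0 -[RHS](coaction0 k m).
  by apply: eq_coaction => i; rewrite big_ord0.
rewrite big_ord_recl -IHn -coaction_linearr.
by apply: eq_coaction => i; rewrite big_ord_recl.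
Qed.

Lemma coactionM (M : {vspace U}) :
    (forall m, m \in M -> \[x, m] \in M) ->
    {in M &, forall u u' v,
       rho \[u, u'] v = rho u (rho u' v) - rho u' (rho u v)} ->
  {in M &, forall m m' k f,
    coaction k \[m, m'] f = coaction k m (fun i => coaction i m' f)
                           - coaction k m' (fun i => coaction i m f)}.
Proof.
move=> idM rhoM m m' Mm Mm' k; elim: k m m' Mm Mm' => [|k IHk] m m' Mm Mm' f /=.
  exact: rhoM.
rewrite lie_jacobi_der.
have -> : coaction k (\[\[x, m], m'] + \[m, \[x, m']]) f
    = coaction k \[\[x, m], m'] f + coaction k \[m, \[x, m']] f.
  have := coaction_linearl k f 1 \[\[x, m], m'] \[m, \[x, m']].
  by rewrite !scale1r.
rewrite (IHk _ m') ?idM // (IHk m \[x, m']) ?idM // (IHk m m') // !coactionDr.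
set a1 := coaction _ _ _; set a2 := coaction _ _ _; set a3 := coaction _ _ _.
set a4 := coaction _ _ _; set a5 := coaction _ _ _; set a6 := coaction _ _ _.
by rewrite !opprD !addrA (ACl (1*3*5*4*2*6)).
Qed.

(** The action of [m + c x], where [x] acts as the shift. *)
Definition coaction_line (m : U) (c : F) (f : nat -> V) (k : nat) : V :=
  coaction k m f + c *: f k.+1.

Lemma coaction_lineM (M : {vspace U}) :
    (forall m, m \in M -> \[x, m] \in M) ->
    {in M &, forall u u' v,
       rho \[u, u'] v = rho u (rho u' v) - rho u' (rho u v)} ->
  {in M &, forall m m' c c' f k,
    coaction k (- c' *: \[x, m] + (c *: \[x, m'] + \[m, m'])) f
      = coaction_line m c (coaction_line m' c' f) k
      - coaction_line m' c' (coaction_line m c f) k}.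
Proof.
move=> idM rhoM m m' Mm Mm' c c' f k.
have lin k1 m1 m2 b (g : nat -> V) : coaction k1 m1 (coaction_line m2 b g)
    = coaction k1 m1 (fun i => coaction i m2 g)
      + b *: coaction k1 m1 (fun i => g i.+1).
  rewrite addrC -coaction_linearr.
  by apply: eq_coaction => i; rewrite addrC.
rewrite !coaction_linearl (coactionM idM rhoM Mm Mm') {1 3}/coaction_line !lin.
rewrite /coaction_line /= !scalerDr !scalerA scaleNr !opprD !addrA.
by rewrite [RHS](ACl (8*3*1*6*2*9*4*7*5*10)) /= (mulrC c') !addrK.
Qed.

(** If the [q]-fold shift obeys the Leibniz rule for [(ad x)^q], then so does
    its p-th power for [(ad x)^(q p)], because the mixed binomial terms vanish. *)
Lemma coaction_addp (p q : nat) :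
    p \in [pchar F] ->
    (forall k m f, coaction (k + q) m f = coaction k (iter q (lie x) m) f
                     + coaction k m (fun i => f (i + q)%N)) ->
  forall k m f, coaction (k + q * p) m f = coaction k (iter (q * p) (lie x) m) f
                     + coaction k m (fun i => f (i + q * p)%N).
Proof.
move=> charFp Eq k m f.
pose T n i j :=
  coaction (k + q * n) (iter (q * i) (lie x) m) (fun l => f (l + q * j)%N).
have TS n i j : T n.+1 i j = T n i.+1 j + T n i j.+1.
  rewrite /T mulnS addnCA addnC Eq -iterD -mulnS; congr (_ + _).
  by apply: eq_coaction => l; rewrite mulnS addnA.
have Vp (v : V) : v *+ p = 0 by rewrite -scaler_nat pcharf0 // scale0r.
have f0 : (fun l => f (l + 0)%N) =1 f by move=> l; rewrite addn0.
have := pascal_expansion_prime (pcharf_prime charFp) Vp TS 0%N 0%N.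
by rewrite /T !muln0 !addn0 add0n !(eq_coaction _ _ f0).
Qed.

Lemma coaction_addpX (p e : nat) :
    p \in [pchar F] ->
  forall k m f, coaction (k + p ^ e) m f = coaction k (iter (p ^ e) (lie x) m) f
                     + coaction k m (fun i => f (i + p ^ e)%N).
Proof.
move=> charFp; elim: e => [|e IHe] k m f.
  rewrite expn0 addn1 /=; congr (_ + _).
  by apply: eq_coaction => i; rewrite addn1.
by rewrite expnSr; apply: coaction_addp.
Qed.

(** The recurrence says that [f] is killed by [P(S)], where [S] is the shift and
    [P] a p-polynomial with [P(ad x) m = 0]; by the Leibniz rule for the
    [S^(p^e)], also [P(S)(m f) = (P(ad x) m) f + m (P(S) f) = 0]. *)
Lemma coaction_recurrent (p n : nat) (a : 'I_n -> F) m f :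
    p \in [pchar F] ->
    iter (p ^ n) (lie x) m = \sum_(e < n) a e *: iter (p ^ e) (lie x) m ->
    recurrent (p ^ n) a (fun e => p ^ e)%N f ->
  recurrent (p ^ n) a (fun e => p ^ e)%N (fun k => coaction k m f).
Proof.
move=> charFp am fR k; rewrite coaction_addpX // am coaction_suml.
have -> : coaction k m (fun i => f (i + p ^ n)%N)
    = coaction k m (fun i => \sum_(e < n) a e *: f (i + p ^ e)%N).
  exact: eq_coaction.
rewrite coaction_sumr -big_split /=; apply: eq_bigr => e _.
by rewrite coaction_addpX // scalerDr.
Qed.

End Coinduction.

(** * Faithful representations of soluble Lie algebras *)

Lemma mem_span_prefix (F : fieldType) (W : vectType F) (w : nat -> W) :
  exists n, w n.+1 \in <<mkseq w n.+1>>%VS.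
Proof.
set d := \dim {:W}.
have [/existsP[n wn]|/existsPn no] :=
  boolP [exists n : 'I_d.+1, w n.+1 \in <<mkseq w n.+1>>%VS].
  by exists n.
suff dim_ge n : (n <= d.+1)%N -> (n <= \dim <<mkseq w n.+1>>)%N.
  by have := leq_trans (dim_ge _ (leqnn _)) (dimvS (subvf _)); rewrite ltnn.
elim: n => // n IHn ltnd; apply: leq_ltn_trans (IHn (ltnW ltnd)) _.
rewrite ltnNge; apply: contra (no (Ordinal ltnd)) => dim_le /=.
have sub: (<<mkseq w n.+1>> <= <<mkseq w n.+2>>)%VS.
  rewrite /mkseq -[n.+2]addn1 iotaD map_cat span_cat. exact: addvSl.
have /eqP -> : <<mkseq w n.+1>>%VS == <<mkseq w n.+2>>%VS by rewrite eqEdim sub.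
by apply/memv_span/map_f; rewrite mem_iota add0n ltnSn.
Qed.

(** Among the powers [(ad x)^(p^e)] in the finite-dimensional space of
    operators one is a combination of the earlier ones. The exponent [n.+1] is
    positive, so that the recurrence has order at least 2. *)
Lemma ad_p_polynomial (F : fieldType) (U : lieAlgType F) (p : nat) (x : U) :
  exists (n : nat) (a : 'I_n.+1 -> F), forall m,
    iter (p ^ n.+1) (lie x) m = \sum_(e < n.+1) a e *: iter (p ^ e) (lie x) m.
Proof.
pose w e := iter (p ^ e) (fun g => (linfun (lie x) \o g)%VF) (\1%VF : 'End(U)).
have wE e m : w e m = iter (p ^ e) (lie x) m.
  by rewrite /w; elim: (p ^ e)%N => [|k IHk] /=; rewrite !lfunE //= IHk lfunE.
have [n] := mem_span_prefix w.
have -> : mkseq w n.+1 = [tuple w e | e < n.+1].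
  by rewrite /mkseq -val_enum_ord -map_comp.
move=> /coord_span wn.
exists n, (fun e => coord [tuple w e | e < n.+1] e (w n.+1)) => m.
rewrite -wE [in LHS]wn sum_lfunE; apply: eq_bigr => e _.
by rewrite scale_lfunE -tnth_nth tnth_mktuple wE.
Qed.

Section Representations.
Import VectorInternalTheory.
Variables (F : fieldType) (U : lieAlgType F).

(** [rho] is defined and linear on all of [U], but is only a faithful
    representation on [M]. So the subalgebras of [U] need no Lie algebra
    structure of their own in an induction along a chain of subalgebras. *)
Definition has_faithful_rep (M : {vspace U}) :=
  exists (V : vectType F) (rho : U -> V -> V),
    [/\ (forall v, linear (rho^~ v)) /\ (forall u, linear (rho u)),
        {in M &, forall u u' v,
           rho \[u, u'] v = rho u (rho u' v) - rho u' (rho u v)},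
        {in M, forall u, (forall v, rho u v = 0) -> u = 0}
      & exists v : V, v != 0].

(** The coinduced module, cut down to the sequences with the recurrence given
    by a p-polynomial killing [ad x]; such a sequence is recorded by its first
    [N] terms. It is faithful as its order [N] is at least 2: the terms [f 0]
    and [f 1] are arbitrary, and the value of [(m + c x) f] at [0] is
    [rho m (f 0) + c (f 1)]. *)
Lemma faithful_rep_add_line (p : nat) (M : {vspace U}) (x : U) :
    p \in [pchar F] -> (forall m, m \in M -> \[x, m] \in M) -> lie_subalg M ->
  x \notin M -> has_faithful_rep M -> has_faithful_rep (M + <[x]>)%VS.
Proof.
move=> charFp idM subM xM [V [rho [[rhoL rhoR] rhoM rhoI [v0 v0_neq0]]]].
have pr_p := pcharf_prime charFp; have p_gt1 := prime_gt1 pr_p.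
have [n [a am]] := ad_p_polynomial p x.
pose N := (p ^ n.+1)%N; pose d (e : 'I_n.+1) := (p ^ e)%N.
have N_gt1 : (1 < N)%N by rewrite -(exp1n n.+1) ltn_exp2r.
have N_gt0 : (0 < N)%N by apply: ltnW.
have ltdN e : (d e < N)%N by rewrite ltn_exp2l.
(* The coordinate along [x] with respect to the decomposition [M + F x]. *)
have [c cD [cM cx]] : exists2 c : U -> F, scalar c &
    (forall m, m \in M -> c m = 0) /\ c x = 1.
  have x_neq0 : x != 0 by apply: contraNneq xM => ->; apply: mem0v.
  have disj : (<[x]> :&: M = 0)%VS.
    apply/eqP; rewrite -subv0; apply/subvP => u /memv_capP[/vlineP[b ->] Mbx].
    rewrite memv0 scaler_eq0 (negPf x_neq0) orbF; apply: contraNT xM => b_neq0.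
    by rewrite -[x]scale1r -(mulVf b_neq0) -scalerA memvZ.
  exists (fun u => coord [tuple x] ord0 (daddv_pi <[x]> M u)).
    by move=> b u u'; rewrite !linearP.
  split=> [m Mm|]; last first.
    rewrite daddv_pi_id ?memv_line //.
    rewrite (coord_free ord0 ord0) ?eqxx //.
    by rewrite free_cons nil_free span_nil memv0 x_neq0.
  have := daddv_pi_add disj (subvP (addvSr _ _) m Mm).
  rewrite [X in _ + X](daddv_pi_id _ Mm) 1?capvC // => /(canRL (addrK _)) ->.
  by rewrite subrr linear0.
(* The component of [u] in [M]. *)
pose mp u := u - c u *: x.
have mp_lin : linear mp.
  by move=> b u u'; rewrite /mp cD /= scalerBr scalerDl scalerA opprD addrACA.
have mpM u : u \in (M + <[x]>)%VS -> mp u \in M.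
  case/memv_addP=> m Mm [_ /vlineP[b ->] ->]; rewrite /mp.
  have -> : c (m + b *: x) = b by rewrite addrC cD cx cM // addr0 mulr1.
  by rewrite addrK.
pose cut (g : {ffun 'I_N -> V}) (j : nat) : V := oapp g 0 (insub j).
have cutE g (j : 'I_N) : cut g j = g j by rewrite /cut valK.
pose ext g := extend N a d (cut g).
have extE g (j : 'I_N) : ext g j = g j by rewrite /ext extend_lt.
have extR g : recurrent N a d (ext g) by apply: extend_recurrent.
have ext_uniq (g : {ffun 'I_N -> V}) f :
    recurrent N a d f -> (forall j : 'I_N, g j = f j) -> ext g =1 f.
  move=> fR eq_gf; apply: recurrent_extend => // k ltkN.
  by rewrite -[k]/(val (Ordinal ltkN)) cutE.
pose op u := coaction_line rho x (mp u) (c u).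
have opR u f : recurrent N a d f -> recurrent N a d (op u f).
  move=> fR k; rewrite /op /coaction_line.
  rewrite (coaction_recurrent rhoL rhoR charFp (am (mp u)) fR).
  rewrite -addSn fR scaler_sumr -big_split; apply: eq_bigr => e _ /=.
  by rewrite scalerDr !scalerA mulrC addSn.
have eq_op u f g : f =1 g -> op u f =1 op u g.
  by move=> eq_fg k;
    rewrite /op /coaction_line (eq_coaction _ _ _ _ eq_fg) eq_fg.
pose act u (g : {ffun 'I_N -> V}) := [ffun j : 'I_N => op u (ext g) j].
have ext_act u g : ext (act u g) =1 op u (ext g).
  by apply: ext_uniq => [|j]; [apply: opR | rewrite ffunE].
have ext_lin b g g' : ext (b *: g + g') =1 (fun k => b *: ext g k + ext g' k).
  apply: ext_uniq => [k|j]; last by rewrite !ffunE !extE.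
  rewrite !extR scaler_sumr -big_split; apply: eq_bigr => e _ /=.
  by rewrite scalerDr !scalerA mulrC.
exists {ffun 'I_N -> V}, act; split.
- split=> [g|u] b; [move=> u u'|move=> g g']; apply/ffunP => j; rewrite !ffunE.
    rewrite /op /coaction_line mp_lin (coaction_linearl _ rhoL) cD /=.
    by rewrite scalerDl scalerDr scalerA addrACA.
  rewrite (eq_op _ _ _ (ext_lin b g g')) /op /coaction_line coaction_linearr //.
  by rewrite !scalerDr !scalerA [c u * b]mulrC addrACA.
- move=> u u' Mu Mu' g; apply/ffunP => j; rewrite !ffunE.
  rewrite !(eq_op _ _ _ (ext_act _ _)).
  set f := ext g; move: {+}j => k.
  have uE w : w = c w *: x + mp w by rewrite addrC subrK.
  have -> : \[u, u']
      = - c u' *: \[x, mp u] + (c u *: \[x, mp u'] + \[mp u, mp u']).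
    rewrite {1}[u]uE {1}[u']uE; move: (mp u) (mp u') (c u) (c u') => m m' c1 c2.
    rewrite lieDl !lieDr !lieZl !lieZr liexx !scaler0 add0r.
    by rewrite [\[m, x]]lieC scalerN scaleNr addrCA.
  set w := _ + _; have Mw : w \in M.
    apply: memvD; [|apply: memvD]; rewrite ?memvZ ?idM ?mpM //.
    by apply: subM; exact: mpM.
  rewrite /op /coaction_line /mp (cM w Mw) !scale0r subr0 addr0 -!/(mp _).
  apply: (coaction_lineM rhoL rhoR idM rhoM); exact: mpM.
- move=> u Mu u0.
  pose delta (i : 'I_N) v : {ffun 'I_N -> V} :=
    [ffun j => if j == i then v else 0].
  have act0 v i : rho (mp u) (delta i v (Ordinal N_gt0))
      + c u *: delta i v (Ordinal N_gt1) = 0.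
    have /ffunP/(_ (Ordinal N_gt0)) := u0 (delta i v).
    rewrite ffunE [RHS]ffunE.
    by rewrite -(extE _ (Ordinal N_gt0)) -(extE _ (Ordinal N_gt1)).
  have rho0 w : rho w 0 = 0.
    by have := rhoR w (-1) 0 0; rewrite scaler0 addr0 scaleN1r addNr.
  have cu0 : c u = 0.
    have := act0 v0 (Ordinal N_gt1); rewrite !ffunE eqxx /= rho0 add0r.
    by move/eqP; rewrite scaler_eq0 (negPf v0_neq0) orbF => /eqP.
  have mp0 : mp u = 0.
    apply: rhoI; first exact: mpM.
    move=> v; have := act0 v (Ordinal N_gt0).
    by rewrite !ffunE eqxx /= scaler0 addr0.
  by rewrite -[u](subrK (c u *: x)) -/(mp u) mp0 cu0 scale0r addr0.
exists [ffun=> v0]; apply: contra v0_neq0 => /eqP/ffunP/(_ (Ordinal N_gt0)).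
by rewrite !ffunE => ->.
Qed.

(** Every subspace between [M] and [W] is an ideal of [W], so [W] is reached
    from [M] by adding one line at a time. *)
Lemma faithful_rep_extend (p : nat) (M W : {vspace U}) :
    p \in [pchar F] -> (M <= W)%VS ->
    (forall x y, x \in W -> y \in W -> \[x, y] \in M) ->
  has_faithful_rep M -> has_faithful_rep W.
Proof.
move=> charFp sMW WWM repM.
suff rep_add (s : seq U) : {subset s <= W} -> has_faithful_rep (M + <<s>>)%VS.
  have WW : {subset vbasis W <= W} by move=> y; apply: vbasis_mem.
  by have := rep_add _ WW; rewrite (span_basis (vbasisP W)) (addv_idPr sMW).
elim: s => [|x s IHs] sW; first by rewrite span_nil addv0.
have sW' : {subset s <= W} by move=> y sy; rewrite sW // inE sy orbT.
rewrite span_cons [(<[x]> + _)%VS]addvC addvA; set N := (M + <<s>>)%VS in IHs *.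
have NW : {subset N <= W}.
  by apply/subvP; rewrite subv_add sMW; apply/span_subvP.
have MN : {subset M <= N} by apply/subvP; apply: addvSl.
have Wx : x \in W by rewrite sW ?mem_head.
have repN := IHs sW'.
have [Nx|xN] := boolP (x \in N).
  by have /addv_idPl -> : (<[x]> <= N)%VS by rewrite -memvE.
apply: (faithful_rep_add_line charFp) => //.
  by move=> m Nm; apply/MN/WWM => //; apply: NW.
by move=> y z Ny Nz; apply/MN/WWM; apply: NW.
Qed.

Lemma mem_lie_prodv (V W : {vspace U}) x y :
  x \in V -> y \in W -> \[x, y] \in lie_prodv V W.
Proof.
move=> Vx Wy; rewrite (coord_vbasis Vx) (coord_vbasis Wy).
rewrite lie_suml; apply: memv_suml => i _; rewrite lie_sumr.
apply: memv_suml => j _; rewrite lieZl lieZr !memvZ //.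
by apply/memv_span/allpairs_f; apply: mem_nth; rewrite size_tuple.
Qed.

Lemma soluble_faithful_rep (p : nat) :
  p \in [pchar F] -> lie_soluble U -> has_faithful_rep fullv.
Proof.
move=> charFp [n Dn0].
have derS k : (derived_series U k.+1 <= derived_series U k)%VS.
  elim: k => [|k IHk]; first exact: subvf.
  apply/span_subvP => _ /allpairsP[[u v] /= [/vbasis_mem Uu /vbasis_mem Uv ->]].
  by apply: mem_lie_prodv; apply: (subvP IHk).
have : has_faithful_rep (derived_series U n).
  exists F^o, (fun _ _ => 0); rewrite Dn0; split.
  - by split=> ? ? ? ?; rewrite scaler0 addr0.
  - by move=> *; rewrite subr0.
  - by move=> u; rewrite memv0 => /eqP.
  by exists 1; apply: oner_neq0.
elim: n {Dn0} => // n IHn repS; apply: IHn.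
apply: (faithful_rep_extend charFp (derS n)) repS => x y.
exact: mem_lie_prodv.
Qed.

(** The Ado-Iwasawa theorem for soluble Lie algebras. *)
Theorem ado_soluble (p : nat) (charFp : p \in [pchar F]) :
    lie_soluble U ->
  exists n (i : 'Hom(U, comm_lie charFp 'M[F]_n.+1)), lie_hom i /\ injective i.
Proof.
move=> solU.
have [V [rho [[rhoL rhoR] rhoM rhoI [v0 v0_neq0]]]] :=
  soluble_faithful_rep charFp solU.
pose r u : {linear V -> V} := HB.pack (rho u)
  (GRing.isLinear.Build F V V *:%R _ (rhoR u)).
(* Matrices act on row vectors from the right, which reverses products; the sign
   restores the order of the commutator. *)
pose R u := - lin1_mx (v2r \o r u \o r2v).
have mulR w u : w *m R u = - v2r (rho u (r2v w)) by rewrite mulmxN mul_rV_lin1.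
have RD : linear R.
  move=> a u u'; apply/row_matrixP => j; rewrite linearP /= !rowE !mulR.
  by rewrite rhoL linearP opprD scalerN.
have RM u u' : R \[u, u'] = R u *m R u' - R u' *m R u.
  apply/row_matrixP => j; rewrite linearB /= !rowE !mulmxA !mulR.
  have rhoN w v : rho w (- v) = - rho w v by apply: (linearN (r w)).
  rewrite ![r2v (- _)]linearN /= !v2rK !rhoN ![v2r (- _)]linearN /= !opprK.
  by rewrite (rhoM _ _ (memvf u) (memvf u')) linearB opprB.
have RI : injective R.
  move=> u u' eqR; apply/eqP; rewrite -subr_eq0; apply/eqP.
  apply: (rhoI _ (memvf _)) => v; rewrite -scaleN1r addrC rhoL scaleN1r addrC.
  apply/eqP; rewrite subr_eq0 -[v]v2rK; apply/eqP; apply: (can_inj (@v2rK _ _)).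
  by apply: oppr_inj; rewrite -!mulR eqR.
have : (0 < dim V)%N.
  case: posnP => // d0; case/eqP: v0_neq0; apply: (can_inj (@v2rK _ _)).
  by apply/rowP => k; have := ltn_ord k; rewrite {2}d0.
move: (dim V) R {mulR} RD RM RI => [//|n] R RD RM RI _.
pose G := comm_lie charFp 'M[F]_n.+1.
pose Rl : {linear U -> G} := HB.pack (R : U -> G)
  (GRing.isLinear.Build F U G *:%R R RD).
exists n, (linfun Rl); split=> [u u'|u u']; rewrite !lfunE /=; first exact: RM.
exact: RI.
Qed.

End Representations.

(** * Solubility *)

Section Solubility.
Variable F : fieldType.
Implicit Types L M U : lieAlgType F.

(** Unlike the derived series, an arbitrary chain can be pulled back and pushed
    forward along homomorphisms. *)
Lemma soluble_chainP L :
  lie_soluble L <-> exists n (D : nat -> {vspace L}),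
    [/\ forall x, x \in D 0%N, D n = 0%VS
      & forall k x y, x \in D k -> y \in D k -> \[x, y] \in D k.+1].
Proof.
split=> [[n Dn]|[n [D [D0 Dn DS]]]].
  exists n, (derived_series L); split=> // [x|k x y]; first exact: memvf.
  exact: mem_lie_prodv.
exists n; apply/eqP; rewrite -subv0 -Dn.
elim: n {Dn} => [|n IHn]; first by apply/subvP => x _; apply: D0.
apply/span_subvP => _ /allpairsP[[u v] /= [/vbasis_mem Uu /vbasis_mem Uv ->]].
by apply: DS; apply: (subvP IHn).
Qed.

Lemma soluble_inj L M (f : 'Hom(L, M)) :
  lie_hom f -> injective f -> lie_soluble M -> lie_soluble L.
Proof.
move=> homf injf /soluble_chainP[n [D [D0 Dn DS]]]; apply/soluble_chainP.
exists n, (fun k => (f @^-1: D k)%VS); split.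
- by move=> x; rewrite -memv_preim.
- by rewrite Dn lpreim0; apply/eqP/lker0P.
by move=> k x y; rewrite -!memv_preim homf; apply: DS.
Qed.

Lemma soluble_surj L M (f : 'Hom(L, M)) :
  lie_hom f -> (forall y, exists x, f x = y) -> lie_soluble L -> lie_soluble M.
Proof.
move=> homf surf /soluble_chainP[n [D [D0 Dn DS]]]; apply/soluble_chainP.
exists n, (fun k => (f @: D k)%VS); split.
- by move=> y; have [x <-] := surf y; apply: memv_img.
- by rewrite Dn limg0.
move=> k _ _ /memv_imgP[x Dx ->] /memv_imgP[y Dy ->].
by rewrite -homf memv_img ?DS.
Qed.

Lemma soluble_ext U L (f : 'Hom(U, L)) :
    lie_hom f -> (forall x y, \[x, y] \in limg f) ->
  lie_soluble U -> lie_soluble L.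
Proof.
move=> homf brf /soluble_chainP[n [D [D0 Dn DS]]]; apply/soluble_chainP.
exists n.+1, (fun k => if k is k'.+1 then (f @: D k')%VS else fullv); split.
- exact: memvf.
- by rewrite Dn limg0.
case=> [|k] x y.
  move=> _ _; have /memv_imgP[u _ ->] := brf x y.
  by apply: memv_img.
move=> /memv_imgP[u Du ->] /memv_imgP[v Dv ->].
by rewrite -homf memv_img ?DS.
Qed.

End Solubility.

(** * Transporters *)

Section Transporter.
Variables (F : fieldType) (L : lieAlgType F).
Implicit Types A B : {vspace L}.

(** The space of all [x] with [\[x, A] <= B]; normalisers ([A = B]) and
    centralisers ([B = 0]) are of this form. *)
Definition transporter A B : {vspace L} :=
  (\bigcap_(i < \dim A) (linfun (lie_flip (vbasis A)`_i) @^-1: B))%VS.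

Lemma transporterP A B x :
  (x \in transporter A B) <-> (forall a, a \in A -> \[x, a] \in B).
Proof.
split=> [xAB a Aa|xAB].
  rewrite (coord_vbasis Aa) lie_sumr; apply: memv_suml => i _.
  rewrite lieZr memvZ //.
  have: (<[x]> <= transporter A B)%VS by rewrite -memvE.
  by move=> /subv_bigcapP/(_ i isT); rewrite -memvE -memv_preim lfunE.
rewrite memvE; apply/subv_bigcapP => i _; rewrite -memvE -memv_preim lfunE.
by apply/xAB/vbasis_mem/mem_nth; rewrite size_tuple.
Qed.

Lemma lie_jacobiB (x y z : L) :
  \[\[x, y], z] = \[x, \[y, z]] - \[y, \[x, z]].
Proof. by rewrite (lie_jacobi_der x y z) addrK. Qed.

Lemma transporter_subalg A B :
  (B <= A)%VS -> lie_subalg (transporter A B).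
Proof.
move=> /subvP sBA x y /transporterP xAB /transporterP yAB.
apply/transporterP => a Aa.
by rewrite lie_jacobiB memvB ?xAB ?yAB // sBA ?xAB ?yAB.
Qed.

Lemma iter_lie_mem A B n x a :
    (B <= A)%VS -> (forall a, a \in A -> \[x, a] \in B) -> (0 < n)%N ->
  a \in A -> iter n (lie x) a \in B.
Proof.
move=> /subvP sBA xAB n_gt0 Aa; case: n n_gt0 => // n _.
by elim: n => [|n IHn]; apply: xAB; last exact: sBA.
Qed.

End Transporter.

Section RestrictedTransporter.
Variables (F : fieldType) (p : nat) (L : restrictedLieType F p).
Hypothesis p_gt0 : (0 < p)%N.
Implicit Types A B : {vspace L}.

(** As [B <= A], already one application of [ad x] sends [A] into [B], and
    further ones stay there. *)
Lemma transporter_p_subalg A B : (B <= A)%VS -> p_subalg (transporter A B).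
Proof.
move=> sBA; split; first exact: transporter_subalg.
move=> x /transporterP xAB; apply/transporterP => a Aa.
by rewrite ad_ppow; apply: iter_lie_mem Aa.
Qed.

Lemma transporter_p_ideal A B :
    (B <= A)%VS -> lie_ideal A -> lie_ideal B -> p_ideal (transporter A B).
Proof.
move=> sBA idA idB; split; last exact: transporter_p_subalg.
move=> x y /transporterP yAB; apply/transporterP => a Aa.
by rewrite lie_jacobiB memvB //; [apply/idB/yAB | apply/yAB/idA].
Qed.

Lemma p_idealI A B : p_ideal A -> p_ideal B -> p_ideal (A :&: B)%VS.
Proof.
move=> [idA [subA clA]] [idB [subB clB]]; split; [|split].
- by move=> x y /memv_capP[Ay By]; rewrite memv_cap idA ?idB.
- move=> x y /memv_capP[Ax Bx] /memv_capP[Ay By].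
  by rewrite memv_cap subA ?subB.
by move=> x /memv_capP[Ax Bx]; rewrite memv_cap clA ?clB.
Qed.

End RestrictedTransporter.

(** * Homomorphisms of restricted Lie algebras *)

Section Homs.
Variables (F : fieldType) (p : nat).
Implicit Types L M : restrictedLieType F p.

Definition p_hom L M (f : 'Hom(L, M)) :=
  lie_hom f /\ forall x, f x^[p] = (f x)^[p].

Lemma preim_p_subalg L M (f : 'Hom(L, M)) W :
  p_hom f -> p_subalg W -> p_subalg (f @^-1: W)%VS.
Proof.
move=> [fM fX] [subW clW]; split=> [x y|x]; rewrite -!memv_preim ?fM ?fX.
  exact: subW.
exact: clW.
Qed.

Lemma preim_p_ideal L M (f : 'Hom(L, M)) W :
  p_hom f -> p_ideal W -> p_ideal (f @^-1: W)%VS.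
Proof.
move=> homf [idW subW]; split; last exact: preim_p_subalg.
by move=> x y; rewrite -!memv_preim (proj1 homf); apply: idW.
Qed.

Lemma img_p_subalg L M (f : 'Hom(L, M)) W :
  p_hom f -> p_subalg W -> p_subalg (f @: W)%VS.
Proof.
move=> [fM fX] [subW clW].
split=> [_ _ /memv_imgP[x Wx ->] /memv_imgP[y Wy ->]|_ /memv_imgP[x Wx ->]].
  by rewrite -fM memv_img ?subW.
by rewrite -fX memv_img ?clW.
Qed.

Lemma ppow0 L : (0 < p)%N -> (0 : L)^[p] = 0.
Proof.
by move=> p_gt0; have := ppowZ 0 (0 : L); rewrite expr0n gtn_eqF // !scale0r.
Qed.

Lemma zero_p_ideal L : (0 < p)%N -> p_ideal (0%VS : {vspace L}).
Proof.
move=> p_gt0; split; [|split]=> [x y|x y|x]; rewrite !memv0.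
- by move/eqP=> ->; rewrite liex0.
- by move=> _ /eqP->; rewrite liex0.
by move/eqP=> ->; rewrite ppow0.
Qed.

Lemma lker_p_ideal L M (f : 'Hom(L, M)) :
  (0 < p)%N -> p_hom f -> p_ideal (lker f).
Proof.
by move=> p_gt0 homf; rewrite -lpreim0; apply/preim_p_ideal/zero_p_ideal.
Qed.

End Homs.

(** * Restricted subalgebras *)

Definition p_sub (F : fieldType) (p : nat) (L : restrictedLieType F p)
  (V : {vspace L}) (subV : p_subalg V) : Type := subvs_of V.

Section PSub.
Variables (F : fieldType) (p : nat) (L : restrictedLieType F p).
Variables (V : {vspace L}) (subV : p_subalg V).
Local Notation S := (p_sub subV).
Implicit Types u v w : S.

HB.instance Definition _ := Vector.on S.

Definition p_sub_val u : L := vsval u.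

Lemma p_sub_val_is_linear : linear p_sub_val.
Proof. exact: linearP. Qed.

HB.instance Definition _ :=
  GRing.isLinear.Build F S L *:%R p_sub_val p_sub_val_is_linear.

Definition p_sub_bracket u v : S :=
  Subvs ((proj1 subV) _ _ (subvsP u) (subvsP v)).

Lemma p_sub_linearl v : linear (p_sub_bracket^~ v).
Proof. by move=> a u u'; apply: val_inj; rewrite /= lieDl lieZl. Qed.

Lemma p_sub_linearr u : linear (p_sub_bracket u).
Proof. by move=> a v v'; apply: val_inj; rewrite /= lieDr lieZr. Qed.

Lemma p_subxx u : p_sub_bracket u u = 0.
Proof. by apply: val_inj; rewrite /= liexx. Qed.

Lemma p_sub_jacobi u v w :
  p_sub_bracket u (p_sub_bracket v w) + p_sub_bracket v (p_sub_bracket w u)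
    + p_sub_bracket w (p_sub_bracket u v) = 0.
Proof. by apply: val_inj; rewrite /= lie_jacobi. Qed.

HB.instance Definition _ := Vector_isLie.Build F S
  p_sub_linearl p_sub_linearr p_subxx p_sub_jacobi.

Definition p_sub_ppow u : S := Subvs ((proj2 subV) _ (subvsP u)).

Lemma p_sub_ad_ppow u v : \[p_sub_ppow u, v] = iter p (lie u) v.
Proof.
have valX n : p_sub_val (iter n (lie u) v)
    = iter n (lie (p_sub_val u)) (p_sub_val v) by elim: n => //= n <-.
by apply: val_inj; rewrite /= ad_ppow -valX.
Qed.

Lemma p_sub_ppowZ (a : F) u : p_sub_ppow (a *: u) = a ^+ p *: p_sub_ppow u.
Proof. by apply: val_inj; rewrite /= ppowZ. Qed.

Lemma p_sub_jacobson u v i :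
  p_sub_val (jacobson_s p u v i) = jacobson_s p (p_sub_val u) (p_sub_val v) i.
Proof.
rewrite /jacobson_s linearZ /=; congr (_ *: _).
elim: (p.-1) (i.-1) => [|n IHn] j /=; first by case: eqP; rewrite ?linear0.
by rewrite -IHn; case: j => [|j]; rewrite -?IHn.
Qed.

Lemma p_sub_ppowD u v :
  p_sub_ppow (u + v) = p_sub_ppow u + p_sub_ppow v
    + \sum_(1 <= i < p) jacobson_s p u v i.
Proof.
apply: val_inj; rewrite /= ppowD; congr (_ + _).
rewrite -[RHS]/(p_sub_val _) linear_sum; apply: eq_bigr => i _.
exact/esym/p_sub_jacobson.
Qed.

HB.instance Definition _ := Lie_isRestricted.Build F p S
  p_sub_ad_ppow p_sub_ppowZ p_sub_ppowD.

Lemma p_sub_val_p_hom : p_hom (linfun p_sub_val : 'Hom(S, L)).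
Proof. by split=> [u v|u]; rewrite !lfunE. Qed.

End PSub.

(** * p-envelopes *)

Section Envelopes.
Variables (F : fieldType) (p : nat).
Hypothesis p_gt0 : (0 < p)%N.

Section Theory.
Variables (U : lieAlgType F) (L : restrictedLieType F p) (i : 'Hom(U, L)).
Hypothesis envi : p_envelope i.

Lemma envelope_ind (W : {vspace L}) :
  p_subalg W -> (forall u, i u \in W) -> forall x, x \in W.
Proof.
have [_ _ [_ _ minL]] := envi => subW iW x.
apply: (subvP (minL W subW _)); last exact: memvf.
by apply/subvP => _ /memv_imgP[u _ ->].
Qed.

(** The normaliser of [S] is a [[p]]-subalgebra containing [U]. *)
Lemma envelope_stable_ideal (S : {vspace L}) :
  (forall u s, s \in S -> \[i u, s] \in S) -> lie_ideal S.
Proof.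
move=> iS x s Ss; have := @envelope_ind (transporter S S) _ _ x.
move/(_ _ _)/transporterP; apply=> // [|u].
  exact: transporter_p_subalg.
exact/transporterP/iS.
Qed.

Lemma envelope_stable_img (I : {vspace U}) :
  lie_ideal I -> lie_ideal (i @: I)%VS.
Proof.
have [homi _ _] := envi => idI.
apply: envelope_stable_ideal => u _ /memv_imgP[v Iv ->].
by rewrite -homi memv_img ?idI.
Qed.

(** The image of [U] is an ideal of [L], so the transporter of [L] into it
    contains [U] and is therefore [L]. *)
Lemma envelope_bracket x y : \[x, y] \in limg i.
Proof.
have idU : lie_ideal (limg i).
  by apply: envelope_stable_img => u v _; apply: memvf.
suff : x \in transporter fullv (limg i).
  by move/transporterP; apply; apply: memvf.
apply: envelope_ind x => [|u]; first exact: transporter_p_subalg (subvf _).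
by apply/transporterP => a _; apply: lie_ideall; rewrite ?memv_img ?memvf.
Qed.

Lemma envelope_soluble : lie_soluble U -> lie_soluble L.
Proof.
by have [homi _ _] := envi; apply: soluble_ext homi envelope_bracket.
Qed.

End Theory.

Lemma p_envelopeI (U : lieAlgType F) (L : restrictedLieType F p)
    (i : 'Hom(U, L)) :
    lie_hom i -> injective i ->
    (forall W, p_subalg W -> (forall u, i u \in W) -> forall x, x \in W) ->
  p_envelope i.
Proof.
move=> homi inji indL; split=> //; split.
- by split=> [x y _ _|x _]; apply: memvf.
- exact: subvf.
move=> W subW iW; apply/subvP => x _; apply: indL x => // u.
by apply: (subvP iW); rewrite memv_img ?memvf.
Qed.

(** Take one of least dimension; intersecting it with any other one shows that
    it is contained in it. *)
Lemma smallest_p_subalg_exists (L : restrictedLieType F p) (S : {vspace L}) :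
  exists V, smallest_p_subalg S V.
Proof.
have : p_subalg (fullv : {vspace L}) by split=> [x y _ _|x _]; apply: memvf.
have : (S <= fullv)%VS by apply: subvf.
have [n] := ubnP (\dim (fullv : {vspace L})).
elim: n fullv => // n IHn V ltVn sSV subV.
have [[W [subW sSW nVW]]|noW] := classic (exists W,
    [/\ p_subalg W, (S <= W)%VS & ~~ (V <= W)%VS]).
  apply: (IHn (V :&: W)%VS); last 2 first.
  - by rewrite subv_cap sSV.
  - case: subV subW => sV cV [sW cW]; split=> [x y|x].
      by move=> /memv_capP[Vx Wx] /memv_capP[Vy Wy]; rewrite memv_cap sV ?sW.
    by move=> /memv_capP[Vx Wx]; rewrite memv_cap cV ?cW.
  rewrite -ltnS; apply: leq_trans ltVn; rewrite ltnS ltnNge.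
  apply: contra nVW => dimV.
  have /eqP <- : (V :&: W)%VS == V by rewrite eqEdim capvSl.
  exact: capvSr.
exists V; split=> // W subW sSW; apply/idPn => nVW; apply: noW; by exists W.
Qed.

Lemma envelope_exists (U : lieAlgType F) (L : restrictedLieType F p)
    (j : 'Hom(U, L)) :
    lie_hom j -> injective j ->
  exists (E : restrictedLieType F p) (i : 'Hom(U, E)), p_envelope i.
Proof.
move=> homj injj; have [V [subV sjV minV]] := smallest_p_subalg_exists (limg j).
have jV u : j u \in V by apply: (subvP sjV); rewrite memv_img ?memvf.
pose E : restrictedLieType F p := p_sub subV.
pose i0 u : E := Subvs (jV u).
have i0_lin : linear i0 by move=> a u v; apply: val_inj; rewrite /= linearP.
pose il : {linear U -> E} :=
  HB.pack i0 (GRing.isLinear.Build F U E *:%R i0 i0_lin).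
exists E, (linfun il); apply: p_envelopeI => [u v|u v|W subW iW x].
- by rewrite !lfunE; apply: val_inj; rewrite /= homj.
- by rewrite !lfunE => /(congr1 val) /injj.
pose v := linfun (@p_sub_val F p L V subV).
have subvW : p_subalg (v @: W)%VS.
  exact: img_p_subalg (p_sub_val_p_hom subV) subW.
have /subvP/(_ (val x) (valP x)) : (V <= v @: W)%VS.
  apply: minV => //; apply/subvP => _ /memv_imgP[u _ ->].
  apply/memv_imgP; exists (i0 u); rewrite ?lfunE //=.
  by have := iW u; rewrite lfunE.
by case/memv_imgP=> y Wy; rewrite lfunE => /val_inj ->.
Qed.

Lemma soluble_envelope_exists (charFp : p \in [pchar F]) (U : lieAlgType F) :
    lie_soluble U ->
  exists (L : restrictedLieType F p) (i : 'Hom(U, L)), p_envelope i.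
Proof.
move=> solU; have [n [i [homi inji]]] := ado_soluble charFp solU.
exact: envelope_exists homi inji.
Qed.

End Envelopes.

(** * Quotients of restricted Lie algebras *)

Section Quotients.
Variables (F : fieldType) (p : nat).
Hypothesis p_gt0 : (0 < p)%N.
Implicit Types L M N : restrictedLieType F p.

Definition surjective (U V : Type) (f : U -> V) := forall y, exists x, f x = y.

Lemma p_quot_proj_p_hom L (J : {vspace L}) (pJ : p_ideal J) :
  p_hom (linfun (p_quot_proj pJ) : 'Hom(L, p_quot pJ)).
Proof.
split=> [x y|x]; rewrite !lfunE /=; first exact: lie_quot_projM.
exact: p_quot_projX.
Qed.

Lemma p_quot_proj_surj L (J : {vspace L}) (pJ : p_ideal J) :
  surjective (linfun (p_quot_proj pJ) : 'Hom(L, p_quot pJ)).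
Proof. by move=> y; exists (p_quot_repr y); rewrite lfunE /= p_quot_reprK. Qed.

Lemma p_quot_eq0 L (J : {vspace L}) (pJ : p_ideal J) x :
  (p_quot_proj pJ x == 0) = (x \in J).
Proof. exact: lie_quot_proj_eq0. Qed.

Lemma p_hom_comp L M N (g : 'Hom(M, N)) (f : 'Hom(L, M)) :
  p_hom f -> p_hom g -> p_hom (g \o f)%VF.
Proof.
by move=> [fM fX] [gM gX]; split=> [x y|x]; rewrite !lfunE /= ?fM ?fX ?gM ?gX.
Qed.

Lemma first_isog L M (f : 'Hom(L, M)) (pJ : p_ideal (lker f)) :
  p_hom f -> surjective f -> p_isog (p_quot pJ) M.
Proof.
move=> [fM fX] surf.
have f_repr x : f (p_quot_repr (p_quot_proj pJ x)) = f x.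
  apply/esym/eqP; rewrite -subr_eq0 -linearB -memv_ker.
  exact: lie_quot_projK.
pose g : {linear p_quot pJ -> M} := f \o p_quot_repr (pK := pJ).
have gE x : g (p_quot_proj pJ x) = f x by apply: f_repr.
exists (linfun g); split=> [u v|u|].
- rewrite !lfunE -[u]p_quot_reprK -[v]p_quot_reprK -[\[_, _]]lie_quot_projM.
  by rewrite [LHS]gE !gE fM.
- by rewrite !lfunE -[u]p_quot_reprK -p_quot_projX !gE fX.
have limf y : y \in limg f.
  by have [x <-] := surf y; rewrite memv_img ?memvf.
exists (fun y => p_quot_proj pJ (f^-1%VF y)) => [u|y]; rewrite lfunE.
  rewrite -[RHS]p_quot_reprK; apply: lie_quot_proj_eq.
  by rewrite memv_ker linearB /= limg_lfunVK // subrr.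
by rewrite gE limg_lfunVK.
Qed.

Lemma p_primitive_isog L M : p_isog L M -> p_primitive M -> p_primitive L.
Proof.
move=> [f [fM fX bijf]] [solM [A [[pA A_neq0 minA] cA]]].
have homf : p_hom f by [].
have injf := bij_inj bijf.
have surf y : exists x, y = f x by have [g _ fg] := bijf; exists (g y).
split; first exact: soluble_inj fM injf solM.
exists (f @^-1: A)%VS; split; last first.
  move=> x; rewrite -memv_preim -cA; split=> [xA a Aa|xA a].
    have [b Eb] := surf a; rewrite Eb -fM xA ?linear0 //.
    by rewrite -memv_preim -Eb.
  rewrite -memv_preim => /xA; rewrite -fM => fxa.
  by apply: injf; rewrite fxa linear0.
split; first exact: preim_p_ideal.
  apply: contra A_neq0 => /eqP fA0; rewrite -subv0; apply/subvP => a Aa.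
  have [b Eb] := surf a; have : b \in (f @^-1: A)%VS by rewrite -memv_preim -Eb.
  by rewrite fA0 Eb !memv0 => /eqP ->; rewrite linear0.
move=> B pB sBA B_neq0.
have fB : (f @: B)%VS = A.
  apply: minA.
  - split; last by apply: img_p_subalg => //; case: pB.
    move=> y _ /memv_imgP[b Bb ->]; have [x ->] := surf y.
    by rewrite -fM memv_img //; case: pB => idB _; apply: idB.
  - apply/subvP => _ /memv_imgP[b Bb ->]; rewrite memv_preim.
    exact: (subvP sBA).
  apply: contra B_neq0 => /eqP fB0; rewrite -subv0; apply/subvP => b Bb.
  have : f b \in (f @: B)%VS by rewrite memv_img.
  by rewrite fB0 !memv0 => /eqP fb0; apply/eqP/injf; rewrite fb0 linear0.
apply/eqP; rewrite eqEsubv sBA; apply/subvP => x.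
by rewrite -memv_preim -fB => /memv_imgP[b Bb /injf ->].
Qed.

(** A primitive quotient of [M] is isomorphic to a quotient of [L]. *)
Lemma schunck_quotient (K : restrictedLieType F p -> Prop) L M
    (f : 'Hom(L, M)) :
  p_schunck_class K -> p_hom f -> surjective f -> K L -> K M.
Proof.
move=> [isoK _ KE] homf surf KL; have [solL quotL] := (KE L).1 KL.
apply/KE; split; first by case: homf => fM _; apply: soluble_surj fM surf solL.
move=> B pB primB; set pr := linfun (p_quot_proj pB) : 'Hom(M, p_quot pB).
have homg : p_hom (pr \o f)%VF by apply: p_hom_comp homf (p_quot_proj_p_hom pB).
have surg : surjective (pr \o f)%VF.
  move=> z; have [y <-] := p_quot_proj_surj z; have [x <-] := surf y.
  by exists x; rewrite lfunE.
have pJ := lker_p_ideal p_gt0 homg.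
have isoJ := first_isog pJ homg surg.
by apply: (isoK _ _ isoJ); apply/quotL/(p_primitive_isog isoJ).
Qed.

End Quotients.

(** * Uniqueness of centreless p-envelopes *)

Section EnvelopeAdjoint.
Variables (F : fieldType) (p : nat) (p_gt0 : (0 < p)%N).
Variables (Q : lieAlgType F) (L : restrictedLieType F p) (i : 'Hom(Q, L)).
Hypothesis envi : p_envelope i.

(** The adjoint action of [L] on its ideal [i @: Q], transported to [Q]. *)
Definition envelope_ad_fun (x : L) : 'End(Q) :=
  (i^-1 \o linfun (lie x) \o i)%VF.

Lemma envelope_ad_is_linear : linear envelope_ad_fun.
Proof.
move=> a x y; apply/lfunP => q; rewrite add_lfunE scale_lfunE.
by rewrite !lfunE /= !lfunE /= !lfunE /= lieDl lieZl linearP.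
Qed.

HB.instance Definition _ :=
  GRing.isLinear.Build F L 'End(Q) *:%R envelope_ad_fun envelope_ad_is_linear.

Definition envelope_ad : 'Hom(L, 'End(Q)) := linfun envelope_ad_fun.

Lemma envelope_adE x q : i (envelope_ad x q) = \[x, i q].
Proof.
rewrite /envelope_ad lfunE /= /envelope_ad_fun !lfunE /= !lfunE /=.
by rewrite lfunE limg_lfunVK ?(envelope_bracket p_gt0 envi).
Qed.

Lemma envelope_adM x y q : envelope_ad \[x, y] q
  = envelope_ad x (envelope_ad y q) - envelope_ad y (envelope_ad x q).
Proof.
have [_ inji _] := envi; apply: inji.
by rewrite linearB /= !envelope_adE lie_jacobiB.
Qed.

Lemma envelope_adX x q : envelope_ad x^[p] q = iter p (envelope_ad x) q.
Proof.
have [_ inji _] := envi; apply: inji; rewrite envelope_adE ad_ppow.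
have iterE n : iter n (lie x) (i q) = i (iter n (envelope_ad x) q).
  by elim: n => //= n ->; rewrite envelope_adE.
exact: iterE.
Qed.

Lemma envelope_ad_img q q' : envelope_ad (i q) q' = \[q, q'].
Proof.
by have [homi inji _] := envi; apply: inji; rewrite envelope_adE homi.
Qed.

End EnvelopeAdjoint.

(** Both [E] and [M] act on [Q] by restricted homomorphisms extending [ad], so
    they have the same image, the [[p]]-subalgebra generated by [ad Q]; as [M]
    acts faithfully, [E] maps to [M] through this image. *)
Lemma envelopes_compare (F : fieldType) (p : nat) (p_gt0 : (0 < p)%N)
    (Q : lieAlgType F) (E M : restrictedLieType F p)
    (e : 'Hom(Q, E)) (j : 'Hom(Q, M)) :
    p_envelope e -> p_envelope j ->
    (forall x, (forall q, \[x, j q] = 0) -> x = 0) ->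
  exists f : 'Hom(E, M), p_hom f /\ surjective f.
Proof.
move=> enve envj cj0; set adE := envelope_ad e; set adM := envelope_ad j.
have adM_inj : lker adM == 0%VS.
  apply/lker0P => x y eq_xy; apply/eqP; rewrite -subr_eq0; apply/eqP/cj0 => q.
  by rewrite -envelope_adE // linearB /= -/adM eq_xy subrr lfunE linear0.
have adE_adM x : adE x \in limg adM.
  rewrite memv_preim; move: x; apply: (envelope_ind enve); last first.
    move=> q; rewrite -memv_preim.
    apply/memv_imgP; exists (j q); first exact: memvf.
    by apply/lfunP => q'; rewrite !envelope_ad_img.
  split=> [x y|x]; rewrite -!memv_preim => /memv_imgP[x' _ Ex].
    move=> /memv_imgP[y' _ Ey].
    apply/memv_imgP; exists \[x', y']; first exact: memvf.
    by apply/lfunP => q; rewrite !envelope_adM // -/adE -/adM Ex Ey.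
  apply/memv_imgP; exists x'^[p]; first exact: memvf.
  by apply/lfunP => q; rewrite !envelope_adX // -/adE -/adM Ex.
pose f := (adM^-1 \o adE)%VF.
have fE x : adM (f x) = adE x by rewrite comp_lfunE limg_lfunVK.
have homf : p_hom f.
  split=> [x y|x]; apply: (lker0P adM_inj); rewrite fE; apply/lfunP => q.
    by rewrite !envelope_adM // -/adE -/adM !fE.
  by rewrite !envelope_adX // -/adE -/adM !fE.
exists f; split=> // y.
have : y \in limg f.
  move: y; apply: (envelope_ind envj) => [|q].
    by apply: img_p_subalg homf _; split=> [x y _ _|x _]; apply: memvf.
  apply/memv_imgP; exists (e q); first exact: memvf.
  apply: (lker0P adM_inj); rewrite fE; apply/lfunP => q'.
  by rewrite !envelope_ad_img.
by case/memv_imgP=> x _ ->; exists x.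
Qed.

(** * Abelian Lie algebras with zero p-operation *)

Definition null_restricted (F : fieldType) (p : nat) (charFp : p \in [pchar F])
  (Q : lieAlgType F) (abQ : forall x y : Q, \[x, y] = 0) : Type := Q.

Section NullRestricted.
Variables (F : fieldType) (p : nat) (charFp : p \in [pchar F]).
Variables (Q : lieAlgType F) (abQ : forall x y : Q, \[x, y] = 0).
Local Notation N := (null_restricted charFp abQ).

HB.instance Definition _ := LieAlgebra.on N.

Definition null_ppow (x : N) : N := 0.

Lemma null_ad_ppow (x y : N) : \[null_ppow x, y] = iter p (lie x) y.
Proof.
rewrite lie0x -(prednK (prime_gt0 (pcharf_prime charFp))) iterS.
exact/esym/abQ.
Qed.

Lemma null_ppowZ (a : F) (x : N) : null_ppow (a *: x) = a ^+ p *: null_ppow x.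
Proof. by rewrite scaler0. Qed.

Lemma null_ppowD (x y : N) : null_ppow (x + y) = null_ppow x + null_ppow y
    + \sum_(1 <= i < p) jacobson_s p x y i.
Proof.
rewrite !addr0 big1 ?addr0 // => i _; rewrite /jacobson_s.
case: p (prime_gt1 (pcharf_prime charFp)) => [|[|n]] //= _.
have ab (u v : N) : \[u, v] = 0 := abQ u v.
by rewrite ab addr0; case: (i.-1) => [|k]; rewrite ?ab scaler0.
Qed.

HB.instance Definition _ := Lie_isRestricted.Build F p N
  null_ad_ppow null_ppowZ null_ppowD.

End NullRestricted.

(** A central [z] lies in [A] and spans an ideal, so [A = F z] is central and
    the centraliser [A] of [A] is everything. *)
Lemma primitive_central_line (F : fieldType) (Q : lieAlgType F) (z : Q) :
    lie_primitive Q -> z != 0 -> (forall x, \[z, x] = 0) ->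
  (forall x y : Q, \[x, y] = 0) /\ fullv = <[z]>%VS.
Proof.
move=> [_ [A [[idA A_neq0 minA] cA]]] z_neq0 zC.
have Az : z \in A by apply/cA => a _.
have Cz (y : Q) : y \in <[z]>%VS -> forall x, \[y, x] = 0.
  by case/vlineP=> b -> x; rewrite lieZl zC scaler0.
have AE : <[z]>%VS = A.
  apply: minA.
  - by move=> x y yz; rewrite lieC Cz // oppr0 mem0v.
  - by rewrite -memvE.
  by rewrite -dimv_eq0 dim_vline z_neq0.
have fullA x : x \in A.
  by apply/cA => a; rewrite -AE => /Cz za; rewrite lieC za oppr0.
split=> [x y|]; first by apply: Cz; rewrite AE.
by apply/eqP; rewrite eqEsubv subvf AE andbT; apply/subvP.
Qed.

Lemma null_restricted_atom (F : fieldType) (p : nat) (charFp : p \in [pchar F])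
    (Q : lieAlgType F) (abQ : forall x y : Q, \[x, y] = 0) (z : Q) :
    lie_soluble Q -> z != 0 -> (fullv : {vspace Q}) = <[z]>%VS ->
  p_atom (null_restricted charFp abQ).
Proof.
move=> solQ z_neq0 fullz.
have dim1 : \dim (fullv : {vspace Q}) = 1%N by rewrite fullz dim_vline z_neq0.
split; [exact: solQ | by rewrite -dimv_eq0 [X in X == _]dim1 |].
move=> U _; have [->|U_neq0] := eqVneq U 0%VS; [by left | right].
by apply/eqP; rewrite eqEdim subvf [X in (X <= _)%N]dim1 lt0n dimv_eq0.
Qed.

Lemma restricted_self_envelope (F : fieldType) (p : nat)
    (L : restrictedLieType F p) :
  p_envelope (\1%VF : 'Hom(L, L)).
Proof.
apply: p_envelopeI => [x y|x y|W subW fW x]; rewrite ?id_lfunE //.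
by have := fW x; rewrite id_lfunE.
Qed.

Lemma null_restricted_envelope (F : fieldType) (p : nat)
    (charFp : p \in [pchar F]) (Q : lieAlgType F)
    (abQ : forall x y : Q, \[x, y] = 0) :
  p_envelope (\1%VF : 'Hom(Q, null_restricted charFp abQ)).
Proof.
exact: (restricted_self_envelope (null_restricted charFp abQ)).
Qed.

(** * The p-envelope of a centreless quotient *)

Section EnvelopeOfQuotient.
Variables (F : fieldType) (p : nat) (p_gt0 : (0 < p)%N).
Variables (U : lieAlgType F) (L : restrictedLieType F p) (i : 'Hom(U, L)).
Variables (I : {vspace U}) (idI : lie_ideal I).
Hypothesis envi : p_envelope i.

(** The [[p]]-closure of [I] may meet [U] in more than [I]. Instead divide by
    [J = {x | \[x, U] <= I}], the centraliser of [U / I] in [L]; as [U / I] is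
    centreless, [J] meets [U] exactly in [I]. *)
Lemma centreless_quotient_envelope :
    (forall q : lie_quot idI, (forall q', \[q, q'] = 0) -> q = 0) ->
  exists (J : {vspace L}) (pJ : p_ideal J) (j : 'Hom(lie_quot idI, p_quot pJ)),
    p_envelope j.
Proof.
move=> centreless; have [homi inji _] := envi.
pose J := transporter (limg i) (i @: I)%VS.
have sIU : (i @: I <= limg i)%VS by apply/limgS/subvf.
have pJ : p_ideal J.
  apply: transporter_p_ideal => //; apply: envelope_stable_img => //.
  by move=> u v _; apply: memvf.
have iIJ u : u \in I -> i u \in J.
  move=> Iu; apply/transporterP => _ /memv_imgP[v _ ->].
  by rewrite -homi memv_img // lie_ideall.
have JI u : i u \in J -> u \in I.
  move=> /transporterP iuJ; rewrite -(lie_quot_proj_eq0 idI); apply/eqP.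
  apply: centreless => q'; rewrite -[q']lie_quot_reprK -lie_quot_projM.
  apply/eqP; rewrite lie_quot_proj_eq0.
  have /iuJ : i (lie_quot_repr q') \in limg i by rewrite memv_img ?memvf.
  by rewrite -homi => /memv_imgP[v Iv /inji ->].
pose j0 : {linear lie_quot idI -> p_quot pJ} :=
  p_quot_proj pJ \o (i \o lie_quot_repr (idK := idI)).
have j0E u : j0 (lie_quot_proj idI u) = p_quot_proj pJ (i u).
  apply/esym/lie_quot_proj_eq; rewrite -linearB.
  exact/iIJ/lie_quot_projK.
exists J, pJ, (linfun j0); apply: p_envelopeI => [q q'|q q'|W subW jW x].
- rewrite !lfunE -[q]lie_quot_reprK -[q']lie_quot_reprK -lie_quot_projM.
  rewrite !j0E homi; exact: lie_quot_projM.
- rewrite !lfunE -[q]lie_quot_reprK -[q']lie_quot_reprK !j0E => eq_qq'.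
  apply: lie_quot_proj_eq; apply: JI.
  by rewrite linearB -(p_quot_eq0 pJ) linearB /= eq_qq' subrr.
rewrite -[x]p_quot_reprK -[p_quot_proj _ _](lfunE (p_quot_proj pJ)) memv_preim.
apply: (envelope_ind envi) => [|u].
  exact: preim_p_subalg (p_quot_proj_p_hom pJ) subW.
rewrite -memv_preim lfunE /= -j0E.
by have := jW (lie_quot_proj idI u); rewrite lfunE.
Qed.

End EnvelopeOfQuotient.

(** * p-envelopes that are primitive *)

Section PrimitiveEnvelope.
Variables (F : fieldType) (p : nat) (charFp : p \in [pchar F]).
Variables (Q : lieAlgType F) (M : restrictedLieType F p) (j : 'Hom(Q, M)).
Hypotheses (envj : p_envelope j) (primM : p_primitive M).

Let p_gt0 : (0 < p)%N := prime_gt0 (pcharf_prime charFp).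

(** The centre is a [[p]]-ideal inside [A], so it is [A], and [M] is the
    centraliser [A] of [A]. All [[p]]-subalgebras of the abelian [M = A] are
    [[p]]-ideals. *)
Lemma p_primitive_central_atom (z : M) :
  z != 0 -> (forall x, \[z, x] = 0) -> p_atom M.
Proof.
have [solM [A [[pA A_neq0 minA] cA]]] := primM => z_neq0 zC.
pose Z := transporter (fullv : {vspace M}) 0%VS.
have ZP x : x \in Z <-> (forall y, \[x, y] = 0).
  split=> [/transporterP xZ y|xZ]; first by apply/eqP; rewrite -memv0 xZ ?memvf.
  by apply/transporterP => y _; rewrite xZ mem0v.
have pZ : p_ideal Z.
  apply: transporter_p_ideal; rewrite ?sub0v //.
    by move=> x y _; apply: memvf.
  by case: (zero_p_ideal M p_gt0).
have ZA : (A :&: Z)%VS = A.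
  apply: minA; [exact: p_idealI | exact: capvSl |].
  apply: contraNneq z_neq0 => AZ0.
  rewrite -memv0 -AZ0 memv_cap; apply/andP; split.
    by apply/cA => a _.
  by apply/ZP.
have Mab x y : \[x, y] = 0 :> M.
  have allA w : w \in A.
    apply/cA => a; rewrite -ZA => /memv_capP[_ /ZP aC].
    by rewrite lieC aC oppr0.
  by have := allA x; rewrite -ZA => /memv_capP[_ /ZP ->].
have AE : A = fullv.
  by apply/eqP; rewrite eqEsubv subvf; apply/subvP => x _; apply/cA => a _.
split=> // [|U subU]; first by rewrite -AE.
have [->|U_neq0] := eqVneq U 0%VS; [by left | right].
rewrite -AE; apply: minA => //; last by rewrite AE subvf.
by split=> // x y _; rewrite Mab mem0v.
Qed.

(** [(ad a)^2 = 0] since [A] is an abelian ideal, so [a^[p]] is central. *)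
Lemma p_primitive_base_ppow0 (A : {vspace M}) :
    (forall z : M, (forall x, \[z, x] = 0) -> z = 0) ->
    p_ideal A -> self_centralising A ->
  forall a, a \in A -> a^[p] = 0.
Proof.
move=> noC [idA _] cA a Aa; apply: noC => x; rewrite ad_ppow.
have aax : \[a, \[a, x]] = 0 by apply: (proj2 (cA a) Aa); apply: lie_ideall.
have iter0 n : (1 < n)%N -> iter n (lie a) x = 0.
  by case: n => [|[|n]] // _; elim: n => [|n IHn]; rewrite iterS // IHn liex0.
exact/iter0/prime_gt1/(pcharf_prime charFp).
Qed.

(** Since the p-operation vanishes on [A], all ideals of [M] inside [A] are
    [[p]]-ideals, and [A] is a minimal ideal. The ideal [A] meets the image of
    [Q], as otherwise [\[M, A]] would be zero; so it lies in this image. Ideals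
    of [Q] are ideals of [M], so [A] is a minimal ideal of [Q]. *)
Lemma p_primitive_centreless :
    (forall z : M, (forall x, \[z, x] = 0) -> z = 0) -> lie_soluble Q ->
  lie_primitive Q /\ (forall x, (forall q, \[x, j q] = 0) -> x = 0).
Proof.
have [solM [A [[pA A_neq0 minA] cA]]] := primM => noC solQ.
have [homj injj _] := envj; have [idA _] := pA.
have A0 := p_primitive_base_ppow0 noC pA cA.
have minA' (B : {vspace M}) : lie_ideal B -> (B <= A)%VS -> B != 0%VS -> B = A.
  move=> idB sBA; apply: minA => //; split=> //; split.
    by move=> x y Bx By; apply: idB.
  by move=> b Bb; rewrite A0 ?mem0v // (subvP sBA).
have sAQ : (A <= limg j)%VS.
  suff <- : (A :&: limg j)%VS = A by apply: capvSr.
  apply: minA'; [|exact: capvSl|].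
    move=> x y /memv_capP[Ay _]; rewrite memv_cap idA //=.
    exact: (envelope_bracket p_gt0 envj).
  apply: contra A_neq0 => /eqP A0'; rewrite -subv0; apply/subvP => a Aa.
  rewrite memv0; apply/eqP; apply: noC => x.
  apply/eqP; rewrite -memv0 -A0' memv_cap.
  by rewrite lie_ideall //= (envelope_bracket p_gt0 envj).
split; last first.
  move=> x xQ; apply: noC => y; suff : y \in transporter <[x]> 0.
    move/transporterP/(_ x (memv_line x)); rewrite memv0 lieC oppr_eq0.
    by move/eqP.
  move: y; apply: (envelope_ind envj) => [|q].
    exact: (transporter_p_subalg p_gt0 (sub0v _)).
  apply/transporterP => _ /vlineP[b ->]; rewrite lieC lieZl xQ scaler0 oppr0.
  exact: mem0v.
split=> //; exists (j @^-1: A)%VS; split; last first.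
  move=> q; rewrite -memv_preim -cA; split=> [qA a Aa|qA a].
    have /memv_imgP[b _ Eb] := subvP sAQ a Aa; rewrite Eb -homj qA ?linear0 //.
    by rewrite -memv_preim -Eb.
  rewrite -memv_preim => /qA; rewrite -homj => jqa.
  by apply: injj; rewrite jqa linear0.
split.
- by move=> x y; rewrite -!memv_preim homj; apply: idA.
- apply: contra A_neq0 => /eqP jA0; rewrite -subv0; apply/subvP => a Aa.
  have /memv_imgP[b _ Eb] := subvP sAQ a Aa.
  have : b \in (j @^-1: A)%VS by rewrite -memv_preim -Eb.
  by rewrite jA0 Eb !memv0 => /eqP ->; rewrite linear0.
move=> B idB sBA B_neq0.
have jB : (j @: B)%VS = A.
  apply: minA'; first exact: (envelope_stable_img p_gt0 envj).
    apply/subvP => _ /memv_imgP[b Bb ->]; rewrite memv_preim.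
    exact: (subvP sBA).
  apply: contra B_neq0 => /eqP jB0; rewrite -subv0; apply/subvP => b Bb.
  have : j b \in (j @: B)%VS by rewrite memv_img.
  by rewrite jB0 !memv0 => /eqP jb0; apply/eqP/injj; rewrite jb0 linear0.
apply/eqP; rewrite eqEsubv sBA; apply/subvP => x.
by rewrite -memv_preim -jB => /memv_imgP[b Bb /injj ->].
Qed.

End PrimitiveEnvelope.

(** * The class of Lie algebras with a p-envelope in K *)

Section EnvelopedClass.
Variables (F : fieldType) (p : nat) (charFp : p \in [pchar F]).
Variable K : restrictedLieType F p -> Prop.
Hypotheses (schunckK : p_schunck_class K).
Hypothesis atomsK : forall L : restrictedLieType F p, p_atom L -> K L.

Let p_gt0 : (0 < p)%N := prime_gt0 (pcharf_prime charFp).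

Lemma Envd_soluble U : Envd K U -> lie_soluble U.
Proof.
move=> [L [i [[homi inji _] KL]]]; have [_ _ KE] := schunckK.
by have [solL _] := (KE L).1 KL; apply: soluble_inj homi inji solL.
Qed.

Lemma Envd_primitive_quotient (U : lieAlgType F) (I : {vspace U})
    (idI : lie_ideal I) :
  Envd K U -> lie_primitive (lie_quot idI) -> Envd K (lie_quot idI).
Proof.
move=> [L [i [envi KL]]] primQ.
have [[z [z_neq0 zC]]|noC] := classic (exists z : lie_quot idI,
    z != 0 /\ forall x, \[z, x] = 0).
  have [abQ fullz] := primitive_central_line primQ z_neq0 zC.
  exists (null_restricted charFp abQ), \1%VF; split.
    exact: null_restricted_envelope.
  apply/atomsK; apply: (null_restricted_atom charFp abQ _ z_neq0 fullz).
  by case: primQ.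
have centreless (q : lie_quot idI) : (forall q', \[q, q'] = 0) -> q = 0.
  by move=> qC; have [//|q_neq0] := eqVneq q 0; case: noC; exists q.
have [J [pJ [j envj]]] := centreless_quotient_envelope p_gt0 envi centreless.
exists (p_quot pJ), j; split=> //.
exact: (schunck_quotient p_gt0 schunckK (p_quot_proj_p_hom pJ)
  (@p_quot_proj_surj _ _ _ _ pJ) KL).
Qed.

(** The image of [U] in [M] is isomorphic to [U / I], with [I] the kernel of the
    composite of [i] and [f]. *)
Lemma image_envelope (U : lieAlgType F) (L M : restrictedLieType F p)
    (i : 'Hom(U, L)) (f : 'Hom(L, M)) :
    p_envelope i -> p_hom f -> surjective f ->
  exists (I : {vspace U}) (idI : lie_ideal I) (j : 'Hom(lie_quot idI, M)),
    p_envelope j.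
Proof.
move=> envi homf surf; have [homi _ _] := envi; have [fM _] := homf.
pose g := (f \o i)%VF; have gE u : g u = f (i u) by rewrite lfunE.
have gM u v : g \[u, v] = \[g u, g v] by rewrite !gE homi fM.
have idI : lie_ideal (lker g).
  by move=> u v; rewrite !memv_ker gM => /eqP ->; rewrite liex0.
pose j0 : {linear lie_quot idI -> M} := g \o lie_quot_repr (idK := idI).
have j0E u : j0 (lie_quot_proj idI u) = g u.
  apply/esym/eqP; rewrite -subr_eq0 -linearB -memv_ker; exact: lie_quot_projK.
exists (lker g), idI, (linfun j0).
apply: p_envelopeI => [q q'|q q'|W subW jW x].
- rewrite !lfunE -[q]lie_quot_reprK -[q']lie_quot_reprK -lie_quot_projM.
  by rewrite !j0E gM.
- rewrite !lfunE -[q]lie_quot_reprK -[q']lie_quot_reprK !j0E => eq_qq'.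
  by apply: lie_quot_proj_eq; rewrite memv_ker linearB /= eq_qq' subrr.
have [y <-] := surf x; rewrite memv_preim.
apply: (envelope_ind envi); first exact: preim_p_subalg homf subW.
move=> u; rewrite -memv_preim -gE -j0E.
by have := jW (lie_quot_proj idI u); rewrite lfunE.
Qed.

(** Every p-envelope [L] of [U] is in K, not only a well-chosen one: atoms
    apart, its primitive quotients are determined by the quotients of [U] that
    they envelop. *)
Lemma Envd_of_primitive_quotients (U : lieAlgType F) :
    lie_soluble U ->
    (forall (I : {vspace U}) (idI : lie_ideal I),
       lie_primitive (lie_quot idI) -> Envd K (lie_quot idI)) ->
  Envd K U.
Proof.
move=> solU primU; have [_ _ KE] := schunckK.
have [L [i envi]] := soluble_envelope_exists charFp solU.
exists L, i; split=> //; apply/KE; split.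
  exact: (envelope_soluble p_gt0 envi solU).
move=> J pJ primM; have homp := p_quot_proj_p_hom pJ.
have surp := p_quot_proj_surj (pJ := pJ).
have [I [idI [j envj]]] := image_envelope envi homp surp.
have [[z [z_neq0 zC]]|noC] := classic (exists z : p_quot pJ,
    z != 0 /\ forall x, \[z, x] = 0).
  exact/atomsK/(p_primitive_central_atom charFp primM z_neq0 zC).
have centreless (z : p_quot pJ) : (forall x, \[z, x] = 0) -> z = 0.
  by move=> zC; have [//|z_neq0] := eqVneq z 0; case: noC; exists z.
have [homj injj _] := envj; have [solM _] := primM.
have solQ := soluble_inj homj injj solM.
have [primQ cQ] := p_primitive_centreless charFp envj primM centreless solQ.
have [E [e [enve KE']]] := primU _ idI primQ.
have [f [homf surf]] := envelopes_compare p_gt0 enve envj cQ.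
exact: (schunck_quotient p_gt0 schunckK homf surf KE').
Qed.

Lemma Envd_isog : lie_class (Envd K).
Proof.
move=> U V [f [homf bijf]] [L [i [envi KL]]]; have [homi inji _] := envi.
have [g fK gK] := bijf; have f_inj := bij_inj bijf.
have fVK v : f (f^-1%VF v) = v.
  by rewrite limg_lfunVK // -[v]gK memv_img ?memvf.
exists L, (i \o f^-1)%VF; split=> //.
apply: p_envelopeI => [u v|u v|W subW iW].
- by rewrite !lfunE /= -homi; congr (i _); apply: f_inj; rewrite homf !fVK.
- by rewrite !lfunE /= => /inji eq_uv; rewrite -[u]fVK eq_uv fVK.
apply: (envelope_ind envi) => // u.
have := iW (f u); rewrite lfunE /=; suff -> : f^-1%VF (f u) = u by [].
by apply: f_inj; rewrite fVK.
Qed.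

End EnvelopedClass.

Theorem theorem9p8 (F : fieldType) (p : nat) (charFp : p \in [pchar F])
    (K : restrictedLieType F p -> Prop) (schunckK : p_schunck_class K)
    (atomsK : forall L : restrictedLieType F p, p_atom L -> K L) :
  schunck_class (Envd K).
Proof.
split; first exact: Envd_isog.
  have [_ [L KL] _] := schunckK.
  by exists L, L, \1%VF; split=> //; apply: restricted_self_envelope.
move=> U; split=> [envU|[solU primU]].
  split; first exact: (Envd_soluble schunckK).
  by move=> I idI; apply: Envd_primitive_quotient.
exact: Envd_of_primitive_quotients.
Qed.
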